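(* Let $\{\beta_n\}_{n\ge1}$ be a sequence of real numbers with $\beta_n\ge e$ and $\beta_n/\sqrt n\to0$ as $n\to\infty$. For each $n$ let $b=b_n>0$ and put $$b_1=(2\beta_n^2-1)b,\qquad a=\frac{b_1}{4}+\frac12\sqrt{\frac{b_1^2}{4}+4\beta_n^2\Big(1-b^2\Big(1-\frac{1}{2\beta_n^2}\Big)\Big)},$$ $$r=\frac{1}{6\beta_n^2}\Big(1-\frac{b_1}{a}\Big),\qquad q=\frac{1}{6\beta_n^2}\Big(2+\frac{b_1}{a}\Big).$$ For each $n$ let $X_{ij}$, $1\le i\le n$, $1\le j\le p$, be i.i.d. (across $(i,j)$) mean-zero random variables with $$\mathbf{P}(X_{11}=-a)=q,\qquad \mathbf{P}(X_{11}=b)=1-\frac{1}{2\beta_n^2},\qquad \mathbf{P}(X_{11}=2a)=r.$$ Then, for $b$ sufficiently small (i.e. there are thresholds $b_n^*>0$, depending on $n$ and $\beta_n$, such that for every choice $0<b_n\le b_n^*$ the three-point law assigning masses $q$, $1-\frac{1}{2\beta_n^2}$, $r$ to the points $-a$, $b$, $2a$ respectively is a well-defined mean-zero distribution and the following holds): if $\dfrac{\log p}{d_{n,1}^2}\to\infty$ as $n\to\infty$, then $$\liminf_{n\to\infty}\tau_{n,\mathcal{A}^{\max}}>0.$$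
   Context: $p=p_n$ is a sequence of positive integers (dimension), possibly growing with $n$; $X_i=(X_{i1},\dots,X_{ip})'$ for $i=1,\dots,n$. Self-normalized sum: $T_n=(T_{n1},\dots,T_{np})'$ with $T_{nj}=\sum_{i=1}^n X_{ij}\big/\sqrt{\sum_{i=1}^n X_{ij}^2}$. $Z$ is a standard Gaussian vector in $\mathbb{R}^p$ (mean $0$, identity covariance). $\mathcal{A}^{\max}=\{(-\infty,t]\times\cdots\times(-\infty,t]\subset\mathbb{R}^p: t\in\mathbb{R}\}$ and $\tau_{n,\mathcal{A}^{\max}}=\sup_{A\in\mathcal{A}^{\max}}|\mathbf{P}(T_n\in A)-\mathbf{P}(Z\in A)|$. $d_{n,1}=\sqrt n\,\sigma_n/(n\beta_{n,1})^{1/3}$ where $\sigma_n^2=n^{-1}\sum_{i=1}^n\mathrm{Var}(X_{i1})$ and $\beta_{n,1}=n^{-1}\sum_{i=1}^n\mathbf{E}|X_{i1}|^3$ (here simply $\mathrm{Var}(X_{11})$ and $\mathbf{E}|X_{11}|^3$ for the $n$-th law). *)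

(* Defs.v *)
From HB Require Import structures.
From mathcomp Require Import all_boot all_order all_algebra.
From mathcomp Require Import all_classical all_reals all_analysis.

Set Implicit Arguments.
Unset Strict Implicit.
Unset Printing Implicit Defensive.

Import Order.TTheory GRing.Theory Num.Theory.
Import numFieldNormedType.Exports.

Local Open Scope classical_set_scope.
Local Open Scope ring_scope.

Definition mutually_independent (R : realType) (d : measure_display)
    (Om : measurableType d) (P : probability Om R) (I : finType)
    (X : I -> {RV P >-> R}) : Prop :=
  forall (J : {set I}) (B : I -> set R), (forall i, measurable (B i)) ->
    P [set w | forall i, i \in J -> B i (X i w)] =
    (\prod_(i in J) fine (P (X i @^-1` B i)))%:E.

Definition identically_distributed (R : realType) (d : measure_display)
    (Om : measurableType d) (P : probability Om R) (I : finType)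
    (X : I -> {RV P >-> R}) : Prop :=
  forall (i k : I) (B : set R), measurable B ->
    distribution P (X i) B = distribution P (X k) B.

Definition iid (R : realType) (d : measure_display)
    (Om : measurableType d) (P : probability Om R) (I : finType)
    (X : I -> {RV P >-> R}) : Prop :=
  mutually_independent X /\ identically_distributed X.

Definition standard_gaussian_vector (R : realType) (d : measure_display)
    (Om : measurableType d) (P : probability Om R) (p : nat)
    (Z : 'I_p -> {RV P >-> R}) : Prop :=
  mutually_independent Z /\
  forall (j : 'I_p) (B : set R), measurable B ->
    distribution P (Z j) B = normal_prob 0 1 B.

Definition random_vector (R : realType) (d : measure_display)
    (Om : measurableType d) (P : probability Om R) (p : nat)
    (Z : 'I_p -> {RV P >-> R}) (w : Om) : 'rV[R]_p :=
  \row_j Z j w.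

Definition self_normalized_sum (R : realType) (d : measure_display)
    (Om : measurableType d) (P : probability Om R) (n p : nat)
    (X : 'I_n -> 'I_p -> {RV P >-> R}) (w : Om) : 'rV[R]_p :=
  \row_j ((\sum_(i < n) X i j w) / Num.sqrt (\sum_(i < n) X i j w ^+ 2)).

Definition Amax (R : realType) (p : nat) : set (set 'rV[R]_p) :=
  [set A | exists t : R, A = [set x : 'rV[R]_p | forall j, x ord0 j <= t]].

Definition tau (R : realType) (d : measure_display) (Om : measurableType d)
    (P : probability Om R) (d' : measure_display) (Om' : measurableType d')
    (P' : probability Om' R) (p : nat)
    (T : Om -> 'rV[R]_p) (Z : Om' -> 'rV[R]_p)
    (calA : set (set 'rV[R]_p)) : \bar R :=
  ereal_sup [set `|P (T @^-1` A) - P' (Z @^-1` A)|%E | A in calA].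

Section column_moments.
Variables (R : realType) (d : measure_display) (Om : measurableType d).
Variables (P : probability Om R) (n p : nat).
Variables (X : 'I_n -> 'I_p -> {RV P >-> R}) (j : 'I_p).

Definition sigma_col : R :=
  Num.sqrt (n%:R^-1 * \sum_(i < n) fine ('V_P[X i j])%E).

Definition beta_col : R :=
  n%:R^-1 * \sum_(i < n) fine ('E_P[fun w => (`|X i j w| ^+ 3)%R])%E.

Definition d_col : R :=
  Num.sqrt n%:R * sigma_col / (n%:R * beta_col) `^ (3%:R^-1).

End column_moments.

Section three_point_parameters.
Variables (R : realType) (beta b : R).

Definition tp_b1 : R := (2 * beta ^+ 2 - 1) * b.

Definition tp_radicand : R :=
  tp_b1 ^+ 2 / 4 + 4 * beta ^+ 2 * (1 - b ^+ 2 * (1 - 1 / (2 * beta ^+ 2))).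

Definition tp_a : R := tp_b1 / 4 + 1 / 2 * Num.sqrt tp_radicand.

Definition tp_r : R := 1 / (6 * beta ^+ 2) * (1 - tp_b1 / tp_a).

Definition tp_q : R := 1 / (6 * beta ^+ 2) * (2 + tp_b1 / tp_a).

Definition tp_mid : R := 1 - 1 / (2 * beta ^+ 2).

(* The first line excludes the junk values of Num.sqrt on negative reals and of
   division by zero, and makes the three points distinct. *)
Definition tp_well_defined_mean_zero : Prop :=
  [/\ 0 <= tp_radicand, tp_a != 0 & uniq [:: - tp_a; b; 2 * tp_a]] /\
  [/\ 0 <= tp_q, 0 <= tp_mid, 0 <= tp_r & tp_q + tp_mid + tp_r = 1] /\
  - tp_a * tp_q + b * tp_mid + 2 * tp_a * tp_r = 0.

Definition has_three_point_law (d : measure_display) (Om : measurableType d)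
    (P : probability Om R) (Y : {RV P >-> R}) : Prop :=
  [/\ P (Y @^-1` [set - tp_a]) = tp_q%:E,
      P (Y @^-1` [set b]) = tp_mid%:E &
      P (Y @^-1` [set 2 * tp_a]) = tp_r%:E].

End three_point_parameters.

(* Main.v *)
(** Put x = 1/(2 beta^2).  For tiny b a column is, up to the scale a, a sum of n
    independent steps equal to 2, -1 or nearly 0 with probabilities x/3, 2x/3
    and 1 - x.  Given that K steps are nonzero and u of them equal 2, the
    self-normalized sum is (3u - K)/sqrt(3u + K) with u ~ Bin(K, 1/3).  Large
    values of u increase the denominator too, so the upper tail is lighter than
    the Gaussian one: writing u = K(1 + w)/3, the relative entropy of u/K with
    respect to 1/3 exceeds the Gaussian exponent w^2/(2(w + 2)) by a multiple of
    w^3, whence P(T > t | K) <= C sqrt(K) t^-4 exp(-t^2/2).  Averaging over K,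
    P(T > t) <= pi + C sqrt(n x) t^-4 exp(-t^2/2), where pi = (1 - x)^n is the
    probability that the column is constant, whereas the Gaussian tail is at
    least c t^-1 exp(-t^2/2).

    If p pi < 1/4, compare at the level t where the latter bound equals 1/p: the
    hypothesis log p >> d^2 says exactly that sqrt(n x) << t^3, so the maximum
    of T stays below t with probability about 1 - p pi, while the Gaussian
    maximum exceeds t with probability at least 1 - 1/e.  If p pi >= 1/4, some
    column is constant with probability bounded below, and then T equals
    sqrt(n), its largest possible value; the maximum of T has an atom at sqrt(n)
    and no mass beyond, which no Gaussian maximum can match. *)

Require Import Defs.
From HB Require Import structures.
From mathcomp Require Import all_boot all_order all_algebra.
From mathcomp Require Import all_classical all_reals all_analysis.
From mathcomp Require Import ring lra zify.

Set Implicit Arguments.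
Unset Strict Implicit.
Unset Printing Implicit Defensive.

Import Order.TTheory GRing.Theory Num.Theory.
Import numFieldNormedType.Exports.

Local Open Scope classical_set_scope.
Local Open Scope ring_scope.

(** * Two logarithmic inequalities *)

(** The mean value theorem on [[1, x]]. Differentiability on the whole half-line [x > 0] supplies
    continuity at the endpoint 1. *)
Lemma ge0_from_derive (R : realType) (f df : R -> R) :
  (forall x : R, 0 < x -> is_derive x 1 f (df x)) ->
  (forall x : R, 1 < x -> 0 <= df x) -> f 1 = 0 ->
  forall x, 1 <= x -> 0 <= f x.
Proof.
move=> fd df0 f1 x; rewrite le_eqVlt => /predU1P[<-|x1]; first by rewrite f1.
have cf : {within `[1, x], continuous f}.
  apply: derivable_within_continuous => y; rewrite in_itv/= => /andP[y1 _].
  by have [] := fd y (lt_le_trans ltr01 y1).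
have fd' y : y \in `]1, x[%R -> is_derive y 1 f (df y).
  by rewrite in_itv/= => /andP[y1 _]; exact/fd/(lt_trans ltr01).
have [c] := MVT x1 fd' cf.
rewrite in_itv/= f1 subr0 => /andP[c1 _] ->.
by rewrite mulr_ge0 ?df0// subr_ge0 ltW.
Qed.

(** The rational function has poles at 0 and -2 and agrees with [ln] to third order at 1, so the
    derivative of the difference is the single term [(x - 1)^3 / (x^2 (x + 2)^2)]. *)
Lemma ln_ge_pade (R : realType) (x : R) : 1 <= x ->
  (x - 1) * (5 * x + 1) / (2 * x * (x + 2)) <= ln x.
Proof.
move=> x1.
(* The difference of the two sides, with the rational function in partial fractions. *)
pose f : R -> R := fun x => ln x + (1 / 4) * x^-1 + (27 / 4) * (x + 2)^-1 - 5 / 2.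
have f0 : 0 <= f x.
  apply: (@ge0_from_derive _ f
    (fun x => (x - 1) ^+ 3 / (x ^+ 2 * (x + 2) ^+ 2))) x1.
  - move=> y y0.
    have y20 : y + 2 != 0 by apply: lt0r_neq0; lra.
    have yn0 : y != 0 by exact: lt0r_neq0.
    have dln := is_derive1_ln y0.
    have dinv := is_deriveV yn0 (is_derive_id y 1).
    have d2 : is_derive y 1 (fun z : R => z + 2) (1 + 0) by exact: is_deriveD.
    have dinv2 := @is_deriveV _ (fun z : R => z + 2) _ _ _ y20 d2.
    have D := is_deriveB (is_deriveD (is_deriveD dln (is_deriveZ (1/4) dinv))
                (is_deriveZ (27/4) dinv2)) (is_derive_cst (5/2 : R^o) (y : R^o) 1).
    apply: (@is_derive_eq _ _ _ _ _ _ _ _ D).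
    by rewrite /GRing.scale/=; field; rewrite yn0 y20.
  - move=> y y1; apply: divr_ge0; first by apply: exprn_ge0; lra.
    by rewrite mulr_ge0// exprn_ge0//; lra.
  - by rewrite /f ln1; field.
have -> : (x - 1) * (5 * x + 1) / (2 * x * (x + 2)) = ln x - f x.
  by rewrite /f; field; rewrite !lt0r_neq0//; lra.
by rewrite gerBl.
Qed.

(** The derivative of the difference is [(x - 1)^2 / (2 x^2)]. Divided by [x] the bound is a
    polynomial in [1 / x], so that the failure factor of a binomial weight will contribute only a
    polynomial to the entropy. *)
Lemma ln_le_half_sub_inv (R : realType) (x : R) : 1 <= x ->
  ln x <= (x - x^-1) / 2.
Proof.
move=> x1; rewrite -subr_ge0.
apply: (@ge0_from_derive _ (fun x => (x - x^-1) / 2 - ln x)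
    (fun x => (x - 1) ^+ 2 / (2 * x ^+ 2))) x1.
- move=> y y0.
  have yn0 : y != 0 by exact: lt0r_neq0.
  have D := is_deriveB (is_deriveM (is_deriveB (is_derive_id y 1)
     (is_deriveV yn0 (is_derive_id y 1)))
     (is_derive_cst (2^-1 : R^o) (y : R^o) 1)) (is_derive1_ln y0).
  apply: (@is_derive_eq _ _ _ _ _ _ _ _ D).
  by rewrite /GRing.scale/=; field; rewrite yn0.
- move=> y y1; apply: divr_ge0; first by apply: exprn_ge0; lra.
  by rewrite mulr_ge0// exprn_ge0//; lra.
- by rewrite ln1 invr1; lra.
Qed.

(** * Binomial weights *)

Definition binom_weight (R : realType) (K : nat) (th : R) (k : nat) : R :=
  'C(K, k)%:R * th ^+ k * (1 - th) ^+ (K - k).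

Section binom_weight.
Variable R : realType.
Implicit Types (K k : nat) (th : R).

Lemma binom_weight_ge0 K th k : 0 <= th <= 1 -> 0 <= binom_weight K th k.
Proof.
by move=> /andP[t0 t1]; rewrite !mulr_ge0 ?exprn_ge0 ?subr_ge0.
Qed.

Lemma sum_binom_weight K th : \sum_(0 <= k < K.+1) binom_weight K th k = 1.
Proof.
rewrite big_mkord -[RHS](expr1n _ K) -[in RHS](subrK th 1) exprDn.
by apply: eq_bigr => k _; rewrite /binom_weight -mulr_natl; ring.
Qed.

(** The ratio of consecutive weights, cross-multiplied so that no value of [th] is exceptional. *)
Lemma binom_weightS K th k : (k < K)%N ->
  k.+1%:R * (1 - th) * binom_weight K th k.+1 =
  (K%:R - k%:R) * th * binom_weight K th k.
Proof.
move=> kK; rewrite /binom_weight -natrB ?(ltnW kK)//.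
have /(congr1 (fun i : nat => i%:R : R)) := mul_bin_left K k.
rewrite !natrM => E.
have -> : (1 - th) ^+ (K - k) = (1 - th) * (1 - th) ^+ (K - k.+1).
  by rewrite -exprS subnSK.
rewrite (exprS th).
transitivity (k.+1%:R * 'C(K, k.+1)%:R * th * th ^+ k * (1 - th) * (1 - th) ^+ (K - k.+1)).
  by ring.
by rewrite E; ring.
Qed.

(* Beyond k0 > K/3 the ratio of consecutive weights is at most
   (K - k0) / (2 k0), so the tail is dominated by a geometric series. *)
Lemma binom_weight_third_tail K k0 : (K < 3 * k0)%N -> (k0 <= K)%N ->
  \sum_(k0 <= k < K.+1) binom_weight K (1 / 3 : R) k <=
  2 * k0%:R / (3 * k0%:R - K%:R) * binom_weight K (1 / 3) k0.
Proof.
(* [M] is the sum of the geometric series of ratio [(K - k0) / (2 k0)]. *)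
move=> Kk0 k0K; set M := 2 * _ / _.
have Kk0R : K%:R < 3 * k0%:R :> R by rewrite -natrM ltr_nat.
have k0R : k0%:R <= K%:R :> R by rewrite ler_nat.
have w0 k : 0 <= binom_weight K (1 / 3 : R) k by rewrite binom_weight_ge0//; lra.
have M1 : 1 <= M by rewrite ler_pdivlMr ?subr_gt0//; lra.
(* Downward induction from the last weight, with the constant [M] of [k0] kept fixed. *)
suff H d : (k0 + d <= K)%N -> 
    \sum_(K - d <= k < K.+1) binom_weight K (1 / 3 : R) k <=
    M * binom_weight K (1 / 3) (K - d).
  by have := H (K - k0)%N; rewrite subKn// subnKC//; apply.
elim: d => [_|d IH dK].
  by rewrite subn0 big_nat1 ler_peMl.
rewrite big_ltn ?ltnS ?leq_subr//.
have dlt : (d < K)%N by lia.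
rewrite -[X in \sum_(X <= _ < _) _](_ : (K - d)%N = _); last by lia.
apply: (@le_trans _ _ (binom_weight K (1 / 3) (K - d.+1) + M * binom_weight K (1 / 3) (K - d))).
  by rewrite lerD2l IH//; lia.
have kd : (K - d.+1 < K)%N by lia.
have := binom_weightS (1 / 3) kd; rewrite subnSK//.
 set u := binom_weight _ _ _; set v := binom_weight _ _ _.
have v0 : 0 <= v by exact: w0. have u0 : 0 <= u by exact: w0.
have k0d : k0%:R <= (K - d.+1)%:R :> R by rewrite ler_nat; lia.
have -> : (K - d)%:R = (K - d.+1)%:R + 1 :> R by rewrite -subnSK// -natr1.
set k := (K - d.+1)%:R in k0d *.
move=> E.
have uv : 2 * k0%:R * u <= (K%:R - k0%:R) * v.
  apply: (@le_trans _ _ (2 * (k + 1) * u)).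
    by rewrite ler_wpM2r//; lra.
  have -> : 2 * (k + 1) * u = (K%:R - k) * v by lra.
  by rewrite ler_wpM2r//; lra.
have D0 : 0 < 3 * k0%:R - K%:R :> R by lra.
have ME : M * (3 * k0%:R - K%:R) = 2 * k0%:R by rewrite divfK ?lt0r_neq0.
rewrite -(ler_pM2r D0) mulrDl (mulrAC M u) (mulrAC M v) ME -subr_ge0.
have -> : 2 * k0%:R * v - (v * (3 * k0%:R - K%:R) + 2 * k0%:R * u) =
  (K%:R - k0%:R) * v - 2 * k0%:R * u by ring.
by rewrite subr_ge0.
Qed.

(** When the mean fraction [k0 / K] lies between 1/3 and 8/9, the ratio of consecutive weights at
    distance [j] above the mean is [1 - O((j + 1) / K)]. The constant 12 is 9 + 3, one summand for
    each of the two bounds on [k0 / K]. *)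
Lemma binom_weight_mean_step K k0 j : (0 < k0)%N -> (k0 + j < K)%N ->
  (K <= 3 * k0)%N -> (K <= 9 * (K - k0))%N ->
  (1 - 12 * j.+1%:R / K%:R) * binom_weight K (k0%:R / K%:R : R) (k0 + j) <=
  binom_weight K (k0%:R / K%:R) (k0 + j).+1.
Proof.
move=> k00 jK K3 K9.
have K0 : 0 < K%:R :> R by rewrite ltr0n; lia.
have D0 : 0 < K%:R - k0%:R :> R by rewrite subr_gt0 ltr_nat; lia.
have k0R : 0 < k0%:R :> R by rewrite ltr0n.
have K3R : K%:R <= 3 * k0%:R :> R by rewrite -natrM ler_nat.
have K9R : K%:R <= 9 * (K%:R - k0%:R) :> R by rewrite -natrB -?natrM ?ler_nat; lia.
have := binom_weightS (k0%:R / K%:R : R) jK.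
set u := binom_weight _ _ _; set v := binom_weight _ _ _.
have v0 : 0 <= v.
  by rewrite binom_weight_ge0// divr_ge0//= ler_pdivrMr// mul1r; lra.
rewrite -(natr1 j) -(natr1 (k0 + j)) natrD; set J := j%:R; set k := k0%:R in k0R K3R D0 K9R *.
have J0 : 0 <= J by [].
set KK := K%:R in K0 D0 K3R K9R *.
move=> E.
have {}E : (k + J + 1) * (KK - k) * u = (KK - (k + J)) * k * v.
  have -> : (k + J + 1) * (KK - k) * u = (k + J + 1) * (1 - k / KK) * u * KK.
    by field; rewrite lt0r_neq0.
  by rewrite E; field; rewrite lt0r_neq0.
have P0 : 0 < (k + J + 1) * (KK - k) by rewrite mulr_gt0//; lra.
rewrite -(ler_pM2l P0) E mulrA ler_wpM2r//.
have -> : (k + J + 1) * (KK - k) * (1 - 12 * (J + 1) / KK) =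
  (k + J + 1) * (KK - k) - 12 * (J + 1) * (((k + J + 1) * (KK - k)) / KK).
  by field; rewrite lt0r_neq0.
have H1 : k <= 9 * (k * (KK - k) / KK).
  have -> : 9 * (k * (KK - k) / KK) = k * (9 * (KK - k) / KK) by ring.
  by rewrite ler_peMr ?(ltW k0R)// ler_pdivlMr// mul1r.
have H2 : KK - k <= 3 * (k * (KK - k) / KK).
  have -> : 3 * (k * (KK - k) / KK) = (KK - k) * (3 * k / KK) by ring.
  by rewrite ler_peMr ?(ltW D0)// ler_pdivlMr// mul1r.
have H3 : k * (KK - k) / KK <= (k + J + 1) * (KK - k) / KK.
  by rewrite ler_wpM2r ?invr_ge0 ?(ltW K0)// ler_wpM2r ?(ltW D0)//; lra.
set X := k * (KK - k) / KK in H1 H2 H3.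
set Y := (k + J + 1) * (KK - k) / KK in H3 *.
have H4 : (J + 1) * (k + (KK - k)) <= 12 * (J + 1) * Y.
  have -> : 12 * (J + 1) * Y = (J + 1) * (12 * Y) by ring.
  by rewrite ler_wpM2l//; lra.
rewrite -subr_ge0.
have -> : (KK - (k + J)) * k - ((k + J + 1) * (KK - k) - 12 * (J + 1) * Y) =
  12 * (J + 1) * Y - (J + 1) * (k + (KK - k)) + k by ring.
by rewrite addr_ge0 ?subr_ge0// ltW.
Qed.

(* The weights at distance at most sqrt (K / 24) above the mean are at least half
   of the weight at the mean, and all of them add up to at most 1. *)
Lemma binom_weight_mean_le K k0 : (0 < k0)%N ->
  (K <= 3 * k0)%N -> (K <= 9 * (K - k0))%N ->
  binom_weight K (k0%:R / K%:R : R) k0 <= 10 / Num.sqrt K%:R.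
Proof.
move=> k00 K3 K9.
(* For [K = 0] both sides vanish, the right one because the inverse of 0 is 0. *)
case: (posnP K) => [->|Kpos].
  rewrite /binom_weight bin0n; case: k0 k00 {K3 K9} => //= k0 _.
  by rewrite !mul0r sqrtr0 invr0 mulr0.
have K0 : 0 < K%:R :> R by rewrite ltr0n.
set th := k0%:R / K%:R.
have th01 : 0 <= th <= 1.
  by rewrite divr_ge0//= ler_pdivrMr// mul1r ler_nat; lia.
(* The product of the first [j] step factors is at least [1 - 12 j^2 / K], hence at least 1/2 in the
   range [24 j^2 <= K]. *)
have H j : (24 * (j * j) <= K)%N ->
    (1 - 12 * j%:R ^+ 2 / K%:R) * binom_weight K th k0 <= binom_weight K th (k0 + j).
  elim: j => [_|j IH jK]; first by rewrite addn0 expr0n/= mulr0 mul0r subr0 mul1r.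
  have jK' : (24 * (j * j) <= K)%N by nia.
  have jj : (k0 + j < K)%N by nia.
  rewrite addnS; apply: le_trans (binom_weight_mean_step k00 jj K3 K9).
  have f0 : 0 <= 1 - 12 * j.+1%:R / K%:R :> R.
    rewrite subr_ge0 ler_pdivrMr// mul1r -natrM ler_nat; nia.
  apply: le_trans (ler_wpM2l f0 (IH jK')).
  rewrite [leRHS]mulrA ler_wpM2r ?binom_weight_ge0// -subr_ge0 -(natr1 j).
  have -> : (1 - 12 * (j%:R + 1) / K%:R) * (1 - 12 * j%:R ^+ 2 / K%:R) -
      (1 - 12 * (j%:R + 1) ^+ 2 / K%:R) =
      12 * j%:R * K%:R^-1 + 144 * (j%:R + 1) * j%:R ^+ 2 * K%:R^-1 ^+ 2 :> R by ring.
  by rewrite addr_ge0// !mulr_ge0 ?exprn_ge0 ?invr_ge0 ?addr_ge0.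
(* [J] is the integer part of [sqrt (K / 24)]; the window from [k0] to [k0 + J] has [J + 1]
   weights. *)
have [J JK KJ] : exists2 J, (24 * (J * J) <= K)%N & (K < 24 * (J.+1 * J.+1))%N.
  pose Q i := (24 * (i * i) <= K)%N.
  have Q0 : exists i, Q i by exists 0%N.
  have Qb i : Q i -> (i <= K)%N by rewrite /Q; nia.
  case: (ex_maxnP Q0 Qb) => J QJ maxJ; exists J => //.
  by rewrite ltnNge; apply/negP => /maxJ; rewrite ltnn.
have JS : (k0 + J.+1 <= K.+1)%N by nia.
have : J.+1%:R * (binom_weight K th k0 / 2) <= 1.
  rewrite -[leRHS](sum_binom_weight K th).
  rewrite (@big_cat_nat _ _ _ k0) ?(leq_trans (leq_addr J.+1 k0))//=.
  rewrite (@big_cat_nat _ _ _ (k0 + J.+1) k0 K.+1) ?leq_addr//= addrCA.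
  rewrite -[leLHS]addr0; apply: lerD; last first.
    by rewrite addr_ge0// sumr_ge0// => i _; exact: binom_weight_ge0.
  have -> : J.+1%:R * (binom_weight K th k0 / 2) =
      \sum_(k0 <= i < k0 + J.+1) (binom_weight K th k0 / 2).
    by rewrite sumr_const_nat addKn mulr_natl.
  apply: ler_sum_nat => i /andP[ki iJ].
  have iJ' : (24 * ((i - k0) * (i - k0)) <= K)%N by nia.
  apply: le_trans (le_trans _ (H _ iJ')) _; last by rewrite subnKC.
  rewrite mulrC ler_wpM2r ?binom_weight_ge0// lerBrDr -lerBrDl.
  rewrite ler_pdivrMr// -natrX.
  have : (24 * (i - k0) ^ 2)%:R <= K%:R :> R by rewrite ler_nat -mulnn.
  by rewrite natrM; lra.
move=> B.
rewrite ler_pdivlMr ?sqrtr_gt0//.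
(* Since [24 < 5^2]; doubling for the half weights gives the constant 10. *)
have sK : Num.sqrt K%:R <= 5 * J.+1%:R :> R.
  rewrite -(@ler_pXn2r _ 2) ?nnegrE ?sqrtr_ge0 ?mulr_ge0// sqr_sqrtr ?ltW//.
  by rewrite -natrM -natrX ltr_nat -mulnn; nia.
apply: le_trans (ler_wpM2l (binom_weight_ge0 _ _ th01) sK) _.
lra.
Qed.
End binom_weight.

(** * Conditional tail given the number of nonzero steps *)

(* With x = 1 + w = 3 k / K, the left-hand side bounds minus the relative entropy
   per trial from above; on the right is the Gaussian exponent with a cubic gain. *)
Lemma entropy_gap (R : realType) (x : R) : 1 <= x <= 3 ->
  - ((x - 1) * (5 * x + 1) / (6 * (x + 2))) + (1 / 3 - (3 - x) ^+ 2 / 12) <=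
  - ((x - 1) ^+ 2 / (2 * (x + 1)) + (x - 1) ^+ 3 / 48).
Proof.
move=> /andP[x1 x3]; rewrite -subr_ge0.
have -> : - ((x - 1) ^+ 2 / (2 * (x + 1)) + (x - 1) ^+ 3 / 48) -
  (- ((x - 1) * (5 * x + 1) / (6 * (x + 2))) + (1 / 3 - (3 - x) ^+ 2 / 12)) =
  (x - 1) ^+ 3 * (14 + x - x ^+ 2) / (48 * (x + 1) * (x + 2)).
  by field; rewrite !lt0r_neq0//; lra.
have : 0 <= (x - 1) ^+ 3 by rewrite exprn_ge0// subr_ge0.
have : 0 <= 14 + x - x ^+ 2 by nra.
move=> h1 h2; apply: divr_ge0; first exact: mulr_ge0.
by rewrite !mulr_ge0//; lra.
Qed.

(** Change of measure from success probability 1/3 to the empirical one [k / K]: the likelihood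
    ratio is [exp] of minus [K] times the relative entropy. The two logarithmic inequalities bound
    its success and failure factors, and [entropy_gap] compares the result with the Gaussian
    exponent. Here [y + 2 K = 3 k + K], so the first term is half the squared self-normalized
    sum. *)
Lemma binom_weight_third_le (R : realType) (K k : nat) (y : R) :
  (0 < K)%N -> (K <= 3 * k)%N -> (k <= K)%N -> y = 3 * k%:R - K%:R ->
  binom_weight K (1 / 3) k <= binom_weight K (k%:R / K%:R) k *
    expR (- (y ^+ 2 / (2 * (y + 2 * K%:R)) + y ^+ 3 / (48 * K%:R ^+ 2))).
Proof.
move=> K0 K3 kK ->.
have KR : 0 < K%:R :> R by rewrite ltr0n.
have k0 : (0 < k)%N by lia.
have kR : 0 < k%:R :> R by rewrite ltr0n.
set th : R := k%:R / K%:R; set x : R := 3 * th.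
have x1 : 1 <= x by rewrite /x /th mulrA ler_pdivlMr// mul1r -natrM ler_nat.
have x3 : x <= 3.
  by rewrite /x /th mulrA ler_pdivrMr// -!natrM ler_nat; lia.
have th0 : 0 < th by rewrite divr_gt0.
have th1 : th <= 1 by rewrite /x in x3; lra.
set A := (x - 1) * (5 * x + 1) / (2 * x * (x + 2)).
(* Success factor: [1/3 = th / x] and [1/x <= exp (- A)]. *)
have lowA : (1 / 3 : R) ^+ k <= th ^+ k * expR (k%:R * - A).
  rewrite expRM_natl -exprMn lerXn2r ?nnegrE ?mulr_ge0 ?expR_ge0 ?(ltW th0)//.
  have : expR A <= x.
    by rewrite -[leRHS]lnK ?ler_expR ?ln_ge_pade ?posrE//; lra.
  by rewrite expRN ler_pdivlMr ?expR_gt0// /x; lra.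
set B := K%:R * (1 / 3 - (3 - x) ^+ 2 / 12).
have lowB : (1 - 1 / 3 : R) ^+ (K - k) <= (1 - th) ^+ (K - k) * expR B.
  (* For [k = K] there is no failure factor and only [0 <= B] is to be checked. *)
  have [kltK|] := ltnP k K; last first.
    move=> Kk; have -> : (K - k = 0)%N by lia.
    rewrite !expr0 mul1r -[leLHS]expR0 ler_expR /B mulr_ge0 ?(ltW KR)//.
    nra.
  have Dn0 : 0 < K%:R - k%:R :> R by rewrite subr_gt0 ltr_nat.
  have omth : 1 - th = (K%:R - k%:R) / K%:R by rewrite /th; field; exact: lt0r_neq0.
  have omth0 : 0 < 1 - th by rewrite omth divr_gt0.
  (* [z] is the ratio of the failure probabilities 2/3 and [1 - th]. *)
  pose z := 2 / (3 * (1 - th)).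
  have z1 : 1 <= z by rewrite /z ler_pdivlMr ?mulr_gt0// mul1r; rewrite /x in x1; lra.
  have BE : B = (K - k)%:R * ((z - z^-1) / 2).
    have -> : (K - k)%:R = K%:R * (1 - th).
      by rewrite natrB// omth; field; exact: lt0r_neq0.
    by rewrite /B /x /z; field; rewrite lt0r_neq0.
  rewrite BE expRM_natl -exprMn lerXn2r ?nnegrE ?mulr_ge0 ?expR_ge0 ?(ltW omth0)//; first by lra.
  have -> : 1 - 1 / 3 = (1 - th) * z by rewrite /z; field; rewrite lt0r_neq0.
  rewrite ler_wpM2l ?(ltW omth0)// -[leLHS]lnK ?posrE ?ler_expR ?ln_le_half_sub_inv//; lra.
rewrite /binom_weight; set E := (X in expR X); rewrite -!mulrA ler_wpM2l//.
apply: (@le_trans _ _ (th ^+ k * expR (k%:R * - A) * ((1 - th) ^+ (K - k) * expR B))).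
  by apply: ler_pM lowA lowB; apply: exprn_ge0; lra.
rewrite -mulrA ler_wpM2l ?exprn_ge0 ?(ltW th0)// mulrCA ler_wpM2l ?exprn_ge0 ?subr_ge0//.
rewrite -expRD ler_expR /E.
have kE : k%:R = K%:R * x / 3 by rewrite /x /th; field; exact: lt0r_neq0.
have -> : 3 * k%:R - K%:R = K%:R * (x - 1) by rewrite kE; field.
have -> : k%:R * - A + B = K%:R * (- ((x - 1) * (5 * x + 1) / (6 * (x + 2))) +
    (1 / 3 - (3 - x) ^+ 2 / 12)).
  by rewrite kE /A /B; field; rewrite !lt0r_neq0//; lra.
have -> : - ((K%:R * (x - 1)) ^+ 2 / (2 * (K%:R * (x - 1) + 2 * K%:R)) +
    (K%:R * (x - 1)) ^+ 3 / (48 * K%:R ^+ 2)) =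
    K%:R * - ((x - 1) ^+ 2 / (2 * (x + 1)) + (x - 1) ^+ 3 / 48).
  have -> : K%:R * (x - 1) + 2 * K%:R = K%:R * (x + 1) by ring.
  by field; rewrite !lt0r_neq0//; lra.
by rewrite ler_wpM2l ?(ltW KR)// entropy_gap// x1 x3.
Qed.

Lemma expRN_le_inv (R : realType) (z : R) : 0 < z -> expR (- z) <= z^-1.
Proof.
move=> z0; rewrite expRN lef_pV2 ?posrE ?expR_gt0//.
by have := expR_ge1Dx z; lra.
Qed.

Lemma expRN_le_inv_sqr (R : realType) (z : R) : 0 < z -> expR (- z) <= 4 / z ^+ 2.
Proof.
move=> z0.
have h : expR (- (z / 2)) <= 2 / z.
  by apply: le_trans (expRN_le_inv _) _; [rewrite divr_gt0|rewrite invf_div].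
have -> : - z = 2%:R * - (z / 2) by field.
have -> : 4 / z ^+ 2 = (2 / z) ^+ 2 :> R by field; rewrite lt0r_neq0.
by rewrite expRM_natl lerXn2r ?nnegrE ?expR_ge0// divr_ge0 ?ltW.
Qed.

(* For y <= 5K/3 the factor b saves 1 / sqrt K and exp(-z) <= 1/z suffices; beyond,
   b may be of order 1, which exp(-z) <= 4/z^2 compensates. *)
Lemma third_tail_bound (R : realType) (K : nat) (t y b : R) :
  (0 < K)%N -> 1 <= t -> t * Num.sqrt K%:R <= y -> y <= 2 * K%:R ->
  0 <= b <= 1 -> (3 * y <= 5 * K%:R -> b <= 10 / Num.sqrt K%:R) ->
  2 * K%:R / y * (b * expR (- (y ^+ 3 / (48 * K%:R ^+ 2)))) <=
  4608 * Num.sqrt K%:R / t ^+ 4.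
Proof.
(* Large numerals are kept opaque: unification unfolds them in unary. *)
have [C CE] : exists C : R, C = 4608 by exists 4608.
have [c cE] : exists c : R, c = 960 by exists 960.
have [C0 c0 cC] : [/\ 0 <= C, 0 <= c & c <= C] by split; lra.
rewrite -CE.
move=> K0 t1 ty yK /andP[b0 b1] by5.
have K1 : 1 <= K%:R :> R by rewrite ler1n.
set s := Num.sqrt K%:R in ty by5 *.
have s1 : 1 <= s by rewrite -sqrtr1 ler_sqrt.
have sE : K%:R = s ^+ 2 :> R by rewrite sqr_sqrtr.
have s0 : 0 < s by lra.
have t0 : 0 < t by lra.
have y0 : 0 < y by rewrite (lt_le_trans _ ty)// mulr_gt0.
rewrite sE in yK by5 *.
have z0 : 0 < y ^+ 3 / (48 * (s ^+ 2) ^+ 2) by rewrite divr_gt0 ?mulr_gt0 ?exprn_gt0.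
have ty4 : t ^+ 4 * s ^+ 4 <= y ^+ 4 by rewrite -exprMn lerXn2r ?nnegrE ?mulr_ge0// ltW.
(* The first case gives the constant [2 * 10 * 48 = 960]. The second gives
   [2 * 4 * 48^2 = 4 * 4608], and the factor 4 is absorbed by [y^3 >= 4 s^6]. *)
have [/by5 bs|ybig] := lerP (3 * y) (5 * s ^+ 2).
  apply: (@le_trans _ _ (2 * s ^+ 2 / y * (10 / s * (y ^+ 3 / (48 * (s ^+ 2) ^+ 2))^-1))).
    rewrite ler_wpM2l ?divr_ge0 ?mulr_ge0 ?exprn_ge0 ?(ltW y0) ?(ltW s0)//.
    by rewrite ler_pM ?expR_ge0// expRN_le_inv.
  have -> : 2 * s ^+ 2 / y * (10 / s * (y ^+ 3 / (48 * (s ^+ 2) ^+ 2))^-1) =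
    c * s ^+ 5 / y ^+ 4 by rewrite cE; field; rewrite !lt0r_neq0.
  rewrite ler_pdivrMr ?exprn_gt0// mulrAC ler_pdivlMr ?exprn_gt0//.
  have -> : c * s ^+ 5 * t ^+ 4 = c * s * (t ^+ 4 * s ^+ 4) by ring.
  have y40 : 0 <= y ^+ 4 by rewrite exprn_ge0 ?(ltW y0).
  apply: (@le_trans _ _ (c * s * y ^+ 4)).
    by rewrite ler_wpM2l// mulr_ge0// ltW.
  by rewrite ler_wpM2r// ler_wpM2r// ltW.
apply: (@le_trans _ _ (2 * s ^+ 2 / y * (1 * (4 / (y ^+ 3 / (48 * (s ^+ 2) ^+ 2)) ^+ 2)))).
  rewrite ler_wpM2l ?divr_ge0 ?mulr_ge0 ?exprn_ge0 ?(ltW y0) ?(ltW s0)//.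
  by rewrite ler_pM ?expR_ge0// expRN_le_inv_sqr.
have -> : 2 * s ^+ 2 / y * (1 * (4 / (y ^+ 3 / (48 * (s ^+ 2) ^+ 2)) ^+ 2)) =
  4 * C * s ^+ 10 / (y ^+ 4 * y ^+ 3) by rewrite CE; field; rewrite !lt0r_neq0.
rewrite ler_pdivrMr ?mulr_gt0 ?exprn_gt0// [leRHS]mulrAC ler_pdivlMr ?exprn_gt0//.
have y3 : 4 * s ^+ 6 <= y ^+ 3.
  have h : (5 / 3 * s ^+ 2) ^+ 3 <= y ^+ 3.
    rewrite lerXn2r ?nnegrE ?(ltW y0)//; last lra.
    by rewrite mulr_ge0 ?exprn_ge0 ?(ltW s0)//; lra.
  apply: le_trans h; have -> : (5 / 3 * s ^+ 2) ^+ 3 = 125 / 27 * s ^+ 6 by field.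
  by rewrite ler_wpM2r ?exprn_ge0 ?(ltW s0)//; lra.
have -> : 4 * C * s ^+ 10 * t ^+ 4 = C * ((t ^+ 4 * s ^+ 4) * (4 * s ^+ 6)) by ring.
have Y0 : 0 <= y ^+ 4 * y ^+ 3 by rewrite mulr_ge0 ?exprn_ge0 ?(ltW y0).
apply: (@le_trans _ _ (C * (y ^+ 4 * y ^+ 3))).
  rewrite ler_wpM2l// ler_pM//; first by rewrite mulr_ge0 ?exprn_ge0 ?(ltW s0) ?(ltW t0).
  by rewrite mulr_ge0 ?exprn_ge0 ?(ltW s0).
by rewrite ler_wpM2r// ler_peMr.
Qed.

(** Let [k0] be the least count in the event. The tail from [k0] on is geometric, so it is
    controlled by the weight at [k0]; the change of measure turns that weight into a Gaussian factor
    times the cubic gain, which [third_tail_bound] converts into [sqrt K / t^4]. The slack 1/4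
    leaves room for the nearly zero steps. *)
Lemma conditional_tail (R : realType) : exists2 C : R, 0 <= C &
  forall (K : nat) (t : R), (0 < K)%N -> 1 <= t ->
  \sum_(0 <= k < K.+1 | t * Num.sqrt (3 * k%:R + K%:R) < 3 * k%:R - K%:R + 1 / 4)
     binom_weight K (1 / 3 : R) k <=
  C * Num.sqrt K%:R / t ^+ 4 * expR (- (t ^+ 2 / 2)).
Proof.
have [C [C0 TC]] : exists C : R, 0 <= C /\ forall K t y b,
    (0 < K)%N -> 1 <= t -> t * Num.sqrt K%:R <= y -> y <= 2 * K%:R ->
    0 <= b <= 1 -> (3 * y <= 5 * K%:R -> b <= 10 / Num.sqrt K%:R) ->
    2 * K%:R / y * (b * expR (- (y ^+ 3 / (48 * K%:R ^+ 2)))) <=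
    C * Num.sqrt K%:R / t ^+ 4.
  by exists 4608; split; [lra|exact: third_tail_bound].
exists (C * expR 1); first by rewrite mulr_ge0 ?expR_ge0.
move=> K t K0 t1.
have T := fun y b y1 y2 => TC K t y b K0 t1 y1 y2.
have K1 : 1 <= K%:R :> R by rewrite ler1n.
pose Q k := t * Num.sqrt (3 * k%:R + K%:R) < 3 * k%:R - K%:R + 1 / 4.
have w0 k : 0 <= binom_weight K (1 / 3 : R) k by rewrite binom_weight_ge0//; lra.
have [exQ|noQ] := pselect (exists k, (k <= K)%N && Q k); last first.
  have t0 : 0 <= t by lra.
  rewrite big1_seq; first by rewrite !mulr_ge0 ?invr_ge0 ?exprn_ge0 ?expR_ge0 ?sqrtr_ge0.
  move=> k /andP[Qk]; rewrite mem_index_iota ltnS => /andP[_ kK].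
  by exfalso; apply: noQ; exists k; rewrite kK.
(* Only the implication from the event to [k0 <= k] is used; the sum is enlarged to all [k] from
   [k0] on. *)
case: (ex_minnP exQ) => k0 /andP[k0K Qk0] mink0.
set y : R := 3 * k0%:R - K%:R.
have ge1 : 1 <= 3 * k0%:R + K%:R :> R.
  by rewrite (le_trans K1)// lerDr mulr_ge0.
have s2 : (Num.sqrt (3 * k0%:R + K%:R : R)) ^+ 2 = y + 2 * K%:R.
  by rewrite sqr_sqrtr; [rewrite /y; ring|rewrite (le_trans _ ge1)].
have s1 : 1 <= Num.sqrt (3 * k0%:R + K%:R : R).
  by rewrite -[leLHS]sqrtr1 ler_sqrt // (lt_le_trans _ ge1).
have Kk0 : (K < 3 * k0)%N.
  rewrite -(ltr_nat R) natrM -subr_gt0 -/y.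
  have : 1 <= t * Num.sqrt (3 * k0%:R + K%:R) by rewrite (le_trans t1)// ler_peMr//; lra.
  by move: Qk0; rewrite /Q -/y; lra.
have y1 : 1 <= y by rewrite /y lerBrDl -natrM natr1 ler_nat.
(* As [3 k0 + K >= 2 K], its root exceeds [sqrt K] by a factor 5/4, and the surplus pays for the
   slack 1/4. *)
have ty : t * Num.sqrt K%:R <= y.
  have sK1 : 1 <= Num.sqrt K%:R :> R.
    by rewrite -[leLHS]sqrtr1 ler_sqrt// (lt_le_trans _ K1).
  have h : 5 / 4 * Num.sqrt K%:R <= Num.sqrt (3 * k0%:R + K%:R : R).
    rewrite -(@ler_pXn2r _ 2) ?nnegrE ?mulr_ge0 ?sqrtr_ge0 ?divr_ge0//.
    by rewrite exprMn s2 sqr_sqrtr//; lra.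
  move: Qk0; rewrite /Q -/y => Qk0.
  have h2 : t * (5 / 4 * Num.sqrt K%:R) <= t * Num.sqrt (3 * k0%:R + K%:R : R).
    by rewrite ler_wpM2l//; lra.
  have h3 : 1 <= t * Num.sqrt K%:R by rewrite (le_trans t1)// ler_peMr//; lra.
  by rewrite mulrCA in h2; lra.
(* The slack 1/4 costs at most 1 in the exponent, whence the factor [expR 1] in the constant. *)
have ts : t ^+ 2 / 2 - 1 <= y ^+ 2 / (2 * (y + 2 * K%:R)).
  rewrite ler_pdivlMr; last by lra.
  have : (t * Num.sqrt (3 * k0%:R + K%:R)) ^+ 2 <= (y + 1 / 4) ^+ 2.
    by rewrite lerXn2r ?nnegrE ?mulr_ge0 ?sqrtr_ge0//; move: Qk0; rewrite /Q -/y; lra.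
  rewrite exprMn s2.
  have -> : (y + 1 / 4) ^+ 2 = y ^+ 2 + y / 2 + 1 / 16 by field.
  have -> : (t ^+ 2 / 2 - 1) * (2 * (y + 2 * K%:R)) =
    t ^+ 2 * (y + 2 * K%:R) - 2 * (y + 2 * K%:R) by field.
  by set X := t ^+ 2 * _; lra.
have k0R : 0 < k0%:R :> R by rewrite ltr0n; lia.
have y2K : y <= 2 * K%:R.
  by have : k0%:R <= K%:R :> R; [rewrite ler_nat|rewrite /y; lra].
apply: (@le_trans _ _ (\sum_(k0 <= k < K.+1) binom_weight K (1 / 3 : R) k)).
  rewrite (@big_cat_nat _ _ _ k0)//=; last by rewrite leqW.
  rewrite big1_seq ?add0r; last first.
    move=> k /andP[Qk]; rewrite mem_index_iota => /andP[_ kk0].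
    by have := mink0 k; rewrite /Q Qk (ltnW (leq_trans kk0 k0K)) leqNgt kk0 => /(_ isT).
  by rewrite big_mkcond; apply: ler_sum => k _; case: ifP.
apply: (le_trans (binom_weight_third_tail _ Kk0 k0K)); rewrite -/y.
have th01 : 0 <= (k0%:R / K%:R : R) <= 1.
  by rewrite divr_ge0//= ler_pdivrMr ?mul1r ?ler_nat// ltr0n.
have b0 := binom_weight_ge0 K k0 th01.
have b1 : binom_weight K (k0%:R / K%:R : R) k0 <= 1.
  rewrite -[leRHS](sum_binom_weight K (k0%:R / K%:R : R)) big_mkord.
  rewrite (bigD1 (Ordinal (k0K : (k0 < K.+1)%N)))//= lerDl sumr_ge0// => i _.
  exact: binom_weight_ge0.
have B := @binom_weight_third_le R K k0 y K0 (ltnW Kk0) k0K erefl.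
have M0 : 0 <= 2 * k0%:R / y by rewrite divr_ge0 ?mulr_ge0//; lra.
apply: (le_trans (ler_wpM2l M0 B)).
have {}T := T y (binom_weight K (k0%:R / K%:R) k0) ty y2K.
apply: (@le_trans _ _ (2 * K%:R / y * (binom_weight K (k0%:R / K%:R : R) k0 *
   (expR (- (t ^+ 2 / 2 - 1)) * expR (- (y ^+ 3 / (48 * K%:R ^+ 2))))))).
  apply: ler_pM => //; first by rewrite mulr_ge0 ?expR_ge0.
    by rewrite ler_wpM2r ?invr_ge0 ?ler_wpM2l ?ler_nat//; lra.
  by rewrite ler_wpM2l// -expRD ler_expR opprD; lra.
have -> : - (t ^+ 2 / 2 - 1) = 1 - t ^+ 2 / 2 by ring.
rewrite expRD.
set E1 := expR 1; set E2 := expR (- (t ^+ 2 / 2)); set E3 := expR (- (y ^+ 3 / _)).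
have -> : 2 * K%:R / y * (binom_weight K (k0%:R / K%:R) k0 * (E1 * E2 * E3)) =
  2 * K%:R / y * (binom_weight K (k0%:R / K%:R) k0 * E3) * (E1 * E2) by ring.
have -> : C * E1 * Num.sqrt K%:R / t ^+ 4 * E2 =
  C * Num.sqrt K%:R / t ^+ 4 * (E1 * E2) by ring.
rewrite ler_wpM2r ?mulr_ge0 ?expR_ge0//; apply: T; first by rewrite b0.
move=> y5.
(* [3 y <= 5 K] is the same as [k0 <= 8 K / 9], the range where the weight at the mean is
   [O(1 / sqrt K)]. *)
have k9 : (9 * k0 <= 8 * K)%N.
  by rewrite -(ler_nat R) !natrM; move: y5; rewrite /y; lra.
have k0gt0 : (0 < k0)%N by rewrite -(ltr_nat R).
apply: binom_weight_mean_le (ltnW Kk0) _ => //.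
by move: k9; clear; lia.
Qed.

(** * Averaging over configurations *)

Lemma sum_subsets_card (R : realType) (T : finType) (A : {set T}) (F : nat -> R) :
  \sum_(B : {set T} | B \subset A) F #|B| =
  \sum_(0 <= k < #|A|.+1) 'C(#|A|, k)%:R * F k.
Proof.
rewrite big_mkord.
rewrite (partition_big (fun B : {set T} => inord #|B| : 'I_(#|A|.+1)) predT)//=.
apply: eq_bigr => k _.
transitivity (\sum_(B in [set B : {set T} | B \subset A & #|B| == k]) F k).
  apply: eq_big => [B|B /andP[BA /eqP <-]]; rewrite ?inE.
    by apply: andb_id2l => /subset_leq_card BA; rewrite -val_eqE/= inordK.
  by rewrite inordK// ltnS subset_leq_card.
by rewrite sumr_const cards_draws mulr_natl.
Qed.

Lemma binom_weight_mean (R : realType) (n : nat) (x : R) :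
  \sum_(0 <= k < n.+1) k%:R * binom_weight n x k = n%:R * x.
Proof.
case: n => [|n]; first by rewrite big_nat1 !mul0r.
rewrite big_nat_recl// mul0r add0r.
transitivity (n.+1%:R * x * \sum_(0 <= k < n.+1) binom_weight n x k); last first.
  by rewrite sum_binom_weight mulr1.
rewrite mulr_sumr.
apply: eq_bigr => k _; rewrite /binom_weight subSS exprS.
have /(congr1 (fun i : nat => i%:R : R)) := mul_bin_diag n.+1 k.
rewrite !natrM/= => E.
transitivity (k.+1%:R * 'C(n.+1, k.+1)%:R * x * x ^+ k * (1 - x) ^+ (n - k)); first by ring.
by rewrite -E; ring.
Qed.

(** Jensen's inequality for the square root, by means of its tangent line at the mean [n x]. *)
Lemma binom_weight_mean_sqrt (R : realType) (n : nat) (x : R) :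
  0 < x <= 1 -> (0 < n)%N ->
  \sum_(0 <= k < n.+1) Num.sqrt k%:R * binom_weight n x k <= Num.sqrt (n%:R * x).
Proof.
move=> /andP[x0 x1] n0.
set s := Num.sqrt _.
have nx0 : 0 < n%:R * x by rewrite mulr_gt0// ltr0n.
have s0 : 0 < s by rewrite sqrtr_gt0.
have sE : n%:R * x = s ^+ 2 by rewrite sqr_sqrtr// ltW.
have amgm k : Num.sqrt k%:R <= (k%:R / s + s) / 2 :> R.
  have -> : k%:R = Num.sqrt k%:R ^+ 2 :> R by rewrite sqr_sqrtr.
  rewrite sqrtr_sqr ger0_norm ?sqrtr_ge0// -subr_ge0; set a := Num.sqrt _.
  have -> : (a ^+ 2 / s + s) / 2 - a = (a - s) ^+ 2 / (2 * s) by field; rewrite lt0r_neq0.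
  by rewrite divr_ge0 ?sqr_ge0 ?mulr_ge0 ?(ltW s0).
apply: (@le_trans _ _ (\sum_(0 <= k < n.+1) ((2 * s)^-1 * (k%:R * binom_weight n x k) +
    s / 2 * binom_weight n x k))).
  apply: ler_sum => k _.
  have w0 : 0 <= binom_weight n x k by rewrite binom_weight_ge0// ltW.
  apply: le_trans (ler_wpM2r w0 (amgm k)) _.
  by rewrite le_eqVlt; apply/orP; left; apply/eqP; field; rewrite lt0r_neq0.
rewrite big_split/= -!mulr_sumr binom_weight_mean sum_binom_weight sE.
by rewrite le_eqVlt; apply/orP; left; apply/eqP; field; rewrite lt0r_neq0.
Qed.

(** Among [K] nonzero steps [u] equal 2 and the others -1, in units of [a]: the sum is [3 u - K] and
    the sum of squares [3 u + K]. The slack 1/4 covers all the entries equal to [b] together. *)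
Definition bad_config (R : realType) (t : R) (K u : nat) : bool :=
  t * Num.sqrt (3 * u%:R + K%:R) < 3 * u%:R - K%:R + 1 / 4.

(** [A] is the set of nonzero steps and [B] the set of those equal to 2. For fixed [A] the inner sum
    is a conditional binomial tail, and averaging replaces [sqrt #|A|] by [sqrt (n x)]. The empty
    [A], a constant column, is counted separately. *)
Lemma config_tail (R : realType) : exists2 C : R, 0 <= C &
  forall (n : nat) (x t : R), 0 < x <= 1 -> (0 < n)%N -> 1 <= t ->
  \sum_(A : {set 'I_n} | (0 < #|A|)%N) x ^+ #|A| * (1 - x) ^+ (n - #|A|) *
    \sum_(B : {set 'I_n} | (B \subset A) && bad_config t #|A| #|B|)
      (1 / 3) ^+ #|B| * (1 - 1 / 3) ^+ (#|A| - #|B|) <=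
  C * Num.sqrt (n%:R * x) / t ^+ 4 * expR (- (t ^+ 2 / 2)).
Proof.
have [C C0 CT] := conditional_tail R; exists C => // n x t.
move=> x01 n0 t1.
have /andP[x0 x1] := x01.
have ct (A : {set 'I_n}) : (0 < #|A|)%N ->
    \sum_(B : {set 'I_n} | (B \subset A) && bad_config t #|A| #|B|)
      (1 / 3) ^+ #|B| * (1 - 1 / 3) ^+ (#|A| - #|B|) <=
    C * Num.sqrt #|A|%:R / t ^+ 4 * expR (- (t ^+ 2 / 2)) :> R.
  move=> A0; apply: le_trans (CT _ _ A0 t1).
  rewrite big_mkcondr/=.
  pose F k : R := if bad_config t #|A| k then (1 / 3) ^+ k * (1 - 1 / 3) ^+ (#|A| - k) else 0.
  rewrite (sum_subsets_card A F) [leRHS]big_mkcond/=.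
  apply: ler_sum => k _; rewrite /F /bad_config /binom_weight.
  by case: ifP => _; rewrite ?mulr0// mulrA.
have t0 : 0 <= t by lra.
have omx : 0 <= 1 - x by rewrite subr_ge0.
set D := C / t ^+ 4 * expR (- (t ^+ 2 / 2)).
have D0 : 0 <= D by rewrite !mulr_ge0 ?invr_ge0 ?exprn_ge0 ?expR_ge0.
have ctD (A : {set 'I_n}) : (0 < #|A|)%N -> x ^+ #|A| * (1 - x) ^+ (n - #|A|) *
    \sum_(B : {set 'I_n} | (B \subset A) && bad_config t #|A| #|B|)
      (1 / 3) ^+ #|B| * (1 - 1 / 3) ^+ (#|A| - #|B|) <=
    D * (Num.sqrt #|A|%:R * (x ^+ #|A| * (1 - x) ^+ (n - #|A|))).
  move=> A0; rewrite [leRHS](_ : _ = x ^+ #|A| * (1 - x) ^+ (n - #|A|) *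
     (C * Num.sqrt #|A|%:R / t ^+ 4 * expR (- (t ^+ 2 / 2)))); last by rewrite /D; ring.
  by rewrite ler_wpM2l ?ct// mulr_ge0 ?exprn_ge0 ?(ltW x0).
apply: le_trans (ler_sum _ ctD) _.
apply: (@le_trans _ _ (\sum_(A : {set 'I_n})
    D * (Num.sqrt #|A|%:R * (x ^+ #|A| * (1 - x) ^+ (n - #|A|))))).
  rewrite [leLHS]big_mkcond/=; apply: ler_sum => A _; case: ifP => // _.
  by rewrite (mulr_ge0 D0)// !mulr_ge0 ?sqrtr_ge0 ?exprn_ge0 ?(ltW x0).
rewrite -mulr_sumr (_ : C * Num.sqrt _ / _ * _ = D * Num.sqrt (n%:R * x)); last by rewrite /D; ring.
rewrite ler_wpM2l//.
apply: le_trans (binom_weight_mean_sqrt x01 n0).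
have -> : \sum_(A : {set 'I_n}) Num.sqrt #|A|%:R * (x ^+ #|A| * (1 - x) ^+ (n - #|A|)) =
  \sum_(A : {set 'I_n} | A \subset [set: 'I_n]%SET)
    Num.sqrt #|A|%:R * (x ^+ #|A| * (1 - x) ^+ (n - #|A|)).
  by apply: eq_bigl => A; rewrite finset.subsetT.
rewrite (sum_subsets_card [set: 'I_n]%SET (fun k => Num.sqrt k%:R * (x ^+ k * (1 - x) ^+ (n - k)))).
rewrite cardsT card_ord; apply: ler_sum => k _.
rewrite /binom_weight le_eqVlt; apply/orP; left; apply/eqP; ring.
Qed.

(** * Finite families of events *)

Section finite_probability.
Context (R : realType) (d : measure_display) (Om : measurableType d).
Variable P : probability Om R.
Implicit Types A B : set Om.

Lemma fine_probE A : measurable A -> P A = (fine (P A))%:E.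
Proof. by move=> mA; rewrite fineK// fin_num_measure. Qed.

Lemma fine_prob_ge0 A : 0 <= fine (P A).
Proof. exact: fine_ge0. Qed.

Lemma le_fine_prob A B : measurable A -> measurable B -> A `<=` B ->
  fine (P A) <= fine (P B).
Proof.
move=> mA mB AB; rewrite -lee_fin -!fine_probE//.
by apply: le_measure => //; rewrite inE.
Qed.

Lemma fine_probU_le A B : measurable A -> measurable B ->
  fine (P (A `|` B)) <= fine (P A) + fine (P B).
Proof.
move=> mA mB; rewrite -lee_fin EFinD -!fine_probE//; last exact: measurableU.
exact: measureU2.
Qed.

Lemma fine_prob_bigU_le (I : Type) (r : seq I) (Q : pred I) (F : I -> set Om) :
  (forall i, measurable (F i)) ->
  fine (P (\big[setU/set0]_(i <- r | Q i) F i)) <= \sum_(i <- r | Q i) fine (P (F i)).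
Proof.
move=> mF; elim: r => [|i r IH]; first by rewrite !big_nil measure0.
rewrite !big_cons; case: ifP => // _.
apply: le_trans (fine_probU_le (mF i) _) _; last by rewrite lerD2l.
exact: bigsetU_measurable.
Qed.

Lemma fine_probC A : measurable A -> fine (P (~` A)) = 1 - fine (P A).
Proof. by move=> mA; rewrite probability_setC// [in LHS]fine_probE. Qed.

Lemma measurable_forall_fin (I : finType) (F : I -> set Om) :
  (forall i, measurable (F i)) -> measurable [set w | forall i, F i w].
Proof.
move=> mF; rewrite (_ : mkset _ = \big[setI/setT]_(i : I) F i).
  exact: bigsetI_measurable.
rewrite -bigcap_seq; apply/seteqP; split=> w /= H i; first by move=> _; exact: H.
by apply: H; rewrite /= mem_index_enum.
Qed.

(** Product probabilities of all intersections determine the probability that none of the events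
    occurs, as in inclusion-exclusion. *)
Lemma fine_prob_none (I : finType) (F : I -> set Om) (pi : R) :
  (forall i, measurable (F i)) ->
  (forall S : {set I}, P [set w | forall i, i \in S -> F i w] = (pi ^+ #|S|)%:E) ->
  fine (P [set w | forall i, ~ F i w]) = (1 - pi) ^+ #|I|.
Proof.
move=> mF PF.
have mS (S : {set I}) : measurable [set w | forall i, i \in S -> F i w].
  have : measurable [set w | forall i, (if i \in S then F i else setT) w].
    by apply: measurable_forall_fin => i; case: ifP.
  congr (measurable _); apply/seteqP; split => w /= H i.
    by move=> iS; have := H i; rewrite iS.
  by case: ifP => // /H.
have mN (D : {set I}) : measurable [set w | forall i, i \in D -> ~ F i w].
  have : measurable [set w | forall i, (if i \in D then ~` F i else setT) w].
    by apply: measurable_forall_fin => i; case: ifP => // _; exact: measurableC.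
  congr (measurable _); apply/seteqP; split => w /= H i.
    by move=> iS; have := H i; rewrite iS.
  by case: ifP => // /H.
(* Generalized to events that occur on [S] and fail on a disjoint [D]. To remove [i] from [D], split
   according to whether [F i] occurs. *)
suff H m (D S : {set I}) : #|D| = m -> [disjoint D & S]%B ->
   fine (P ([set w | forall i, i \in S -> F i w] `&`
            [set w | forall i, i \in D -> ~ F i w])) = pi ^+ #|S| * (1 - pi) ^+ m.
  have := H #|I| [set: I]%SET finset.set0.
  rewrite finset.cardsT cards0 expr0 mul1r => <- //; last first.
    by apply/pred0P => x /=; rewrite !inE.
  congr (fine (P _)); apply/seteqP; split => w /=.
    by move=> wF; split => i; rewrite inE.
  by move=> [_ wF] i; apply: wF; rewrite inE.
elim: m D S => [|m IH] D S Dm DS.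
  rewrite expr0 mulr1 (_ : _ `&` _ = [set w | forall i, i \in S -> F i w]) ?PF//.
  apply/seteqP; split => w /=; first by case.
  by move=> H; split=> // i; rewrite (cards0_eq Dm) inE.
have /card_gt0P[i iD] : (0 < #|D|)%N by rewrite Dm.
have iS : i \notin S by rewrite (disjointFr DS iD).
set G := _ `&` [set w | forall i0, i0 \in D -> _].
pose D' := D :\ i; pose S' := i |: S.
have D'm : #|D'| = m by have := cardsD1 i D; rewrite iD Dm add1n => -[].
have D'S : [disjoint D' & S]%B.
  by apply: disjointWl DS; apply/fintype.subsetP => k; rewrite !inE => /andP[].
have D'S' : [disjoint D' & S']%B.
  apply/pred0P => k /=; rewrite !inE; case: eqVneq => //= _.
  by have /pred0P/(_ k) /= := DS.
have E1 := IH _ _ D'm D'S; have E2 := IH _ _ D'm D'S'.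
set A1 := _ `&` _ in E1; set A2 := _ `&` _ in E2.
have mA1 : measurable A1 by exact: measurableI.
have mA2 : measurable A2 by exact: measurableI.
have mG : measurable G by exact: measurableI.
have A1E : A1 = G `|` A2.
  apply/seteqP; split => w.
    move=> [HS HD]; have [Fi|nFi] := pselect (F i w).
      right; split => //= k; rewrite !inE => /orP[/eqP->//|kS]; exact: HS.
    left; split => //= k kD; have [->//|ki] := eqVneq k i.
    by apply: HD; rewrite /= !inE ki.
  move=> [] [HS HD]; split => //= k.
    by rewrite !inE => /andP[_ kD]; exact: HD.
  by move=> kS; apply: HS; rewrite /= !inE kS orbT.
have GA2 : G `&` A2 = set0.
  apply/seteqP; split => w //= -[[_ HD] [HS _]].
  by apply: (HD i iD); apply: HS; rewrite /= !inE eqxx.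
have : fine (P A1) = fine (P G) + fine (P A2).
  apply: EFin_inj; rewrite EFinD -!fine_probE// A1E measureU//.
rewrite E1 E2 cardsU1 iS add1n exprS => E.
rewrite exprS; apply: (addIr (pi * pi ^+ #|S| * (1 - pi) ^+ m)).
by rewrite -E; ring.
Qed.

End finite_probability.

(** The same values [v] are prescribed in every column of [S]. This serves two purposes: the law of
    one column, and the event that given columns are constant. *)
Lemma mutually_independent_column (R : realType) (d : measure_display)
    (Om : measurableType d) (P : probability Om R) (n p : nat)
    (X : 'I_n -> 'I_p -> {RV P >-> R}) (S : {set 'I_p}) (v : 'I_n -> R) :
  mutually_independent (fun ij : 'I_n * 'I_p => X ij.1 ij.2) ->
  P [set w | forall j, j \in S -> forall i, X i j w = v i] =
  (\prod_(j in S) \prod_(i < n) fine (P (X i j @^-1` [set v i])))%:E.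
Proof.
move=> ind.
have := ind [set ij | ij.2 \in S]%SET (fun ij => [set v ij.1]%classic)
  (fun ij => measurable_set1 _).
congr (P _ = _%:E).
  apply/seteqP; split => w /= H.
    by move=> j jS i; apply: (H (i, j)); rewrite inE.
  by move=> [i j]; rewrite inE/= => jS; exact: H.
rewrite exchange_big/= pair_big_dep/=.
by apply: eq_bigl => -[i j]; rewrite inE.
Qed.

(** * The tail of one column *)

Section configurations.
Variables (n : nat) (A B : {set 'I_n}).
Hypothesis BA : B \subset A.

(** Generic in the three values, so that the entries of a column, their squares and their
    probabilities are instances of one pattern. *)
Definition config_value (T : Type) (f g h : T) (i : 'I_n) : T :=
  if i \in B then f else if i \in A then g else h.

Lemma sum_config (R : nzRingType) (f g h : R) :
  \sum_(i < n) config_value f g h i =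
  h * n%:R + (g - h) * #|A|%:R + (f - g) * #|B|%:R.
Proof.
have -> : h * n%:R = \sum_(i < n) h by rewrite sumr_const card_ord mulr_natr.
have -> : (g - h) * #|A|%:R = \sum_(i < n) (if i \in A then g - h else 0).
  by rewrite -big_mkcond/= sumr_const mulr_natr.
have -> : (f - g) * #|B|%:R = \sum_(i < n) (if i \in B then f - g else 0).
  by rewrite -big_mkcond/= sumr_const mulr_natr.
rewrite -!big_split/=; apply: eq_bigr => i _; rewrite /config_value.
have [iB|_] := boolP (i \in B); last by case: ifP; rewrite ?addr0// addrC subrK.
by rewrite (fintype.subsetP BA)// [h + _]addrC subrK addrC subrK.
Qed.

Lemma prod_config (R : comNzRingType) (f g h : R) :
  \prod_(i < n) config_value f g h i =
  f ^+ #|B| * g ^+ (#|A| - #|B|) * h ^+ (n - #|A|).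
Proof.
rewrite (bigID (mem A))/= (bigID (mem B))/=.
congr (_ * _ * _).
- rewrite -prodr_const; apply: eq_big => i.
    by apply: andb_idl; exact: (fintype.subsetP BA).
  by move=> /andP[_ iB]; rewrite /config_value iB.
- rewrite -(cardsDS BA) -prodr_const; apply: eq_big => i.
    by rewrite !inE andbC.
  by move=> /andP[iA /negbTE iB]; rewrite /config_value iB iA.
- have -> : (n - #|A|)%N = #|~: A| by rewrite [RHS]finset.cardsCs finset.setCK card_ord.
  rewrite -prodr_const; apply: eq_big => i.
    by rewrite !inE.
  move=> /negbTE iA; rewrite /config_value iA ifF//.
  by apply/negP => /(fintype.subsetP BA); rewrite iA.
Qed.

Lemma config_value_comp (T U : Type) (F : T -> U) (f g h : T) i :
  F (config_value f g h i) = config_value (F f) (F g) (F h) i.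
Proof. by rewrite /config_value; case: ifP => // _; case: ifP. Qed.

End configurations.

(** Dropping the terms [b^2] only lowers the denominator, and the entries [b] add at most
    [n b <= a / 4] to the sum, which is the slack after division by [a]. *)
Lemma config_bad (R : realType) (n : nat) (A B : {set 'I_n}) (a b t : R) :
  B \subset A -> 0 < a -> 0 < b -> n%:R * b <= a / 4 -> 0 <= t ->
  let x := config_value A B (2 * a) (- a) b in
  t * Num.sqrt (\sum_(i < n) x i ^+ 2) < \sum_(i < n) x i ->
  bad_config t #|A| #|B|.
Proof.
move=> BA a0 b0 nb t0 x.
have An : #|A|%:R <= n%:R :> R by rewrite ler_nat -[leqRHS]card_ord max_card.
have -> : \sum_(i < n) x i = a * (3 * #|B|%:R - #|A|%:R) + b * (n%:R - #|A|%:R).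
  by rewrite /x (sum_config BA); ring.
have -> : \sum_(i < n) x i ^+ 2 =
    a ^+ 2 * (3 * #|B|%:R + #|A|%:R) + b ^+ 2 * (n%:R - #|A|%:R).
  under eq_bigr => i _ do rewrite (config_value_comp _ _ (fun y => y ^+ 2)).
  by rewrite (sum_config BA); ring.
move=> H; rewrite /bad_config.
have V0 : 0 <= 3 * #|B|%:R + #|A|%:R :> R by rewrite addr_ge0 ?mulr_ge0.
rewrite -(ltr_pM2l a0).
have -> : a * (t * Num.sqrt (3 * #|B|%:R + #|A|%:R)) =
    t * Num.sqrt (a ^+ 2 * (3 * #|B|%:R + #|A|%:R)).
  by rewrite sqrtrM ?sqr_ge0// sqrtr_sqr ger0_norm ?(ltW a0)//; ring.
apply: le_lt_trans (lt_le_trans H _).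
  rewrite ler_wpM2l// ler_wsqrtr// lerDl mulr_ge0 ?sqr_ge0//; lra.
have : b * (n%:R - #|A|%:R) <= n%:R * b.
  by rewrite mulrC ler_wpM2r ?(ltW b0)//; have : 0 <= #|A|%:R :> R by []; lra.
by lra.
Qed.

Lemma measurable_RV_preimage (R : realType) (d : measure_display)
    (Om : measurableType d) (P : probability Om R) (Y : {RV P >-> R}) (B : set R) :
  measurable B -> measurable (Y @^-1` B).
Proof. by move=> mB; rewrite -[X in measurable X]setTI; exact: measurable_funP. Qed.

Lemma three_valued_null (R : realType) (d : measure_display)
    (Om : measurableType d) (P : probability Om R) (Y : {RV P >-> R})
    (u v w q m r : R) :
  uniq [:: u; v; w] -> q + m + r = 1 ->
  P (Y @^-1` [set u]) = q%:E -> P (Y @^-1` [set v]) = m%:E ->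
  P (Y @^-1` [set w]) = r%:E ->
  P (Y @^-1` (~` [set u; v; w])) = 0.
Proof.
rewrite /= !inE negb_or andbT => /andP[/andP[uv uw] vw] qmr Pu Pv Pw.
have mY (B : set R) : measurable B -> measurable (Y @^-1` B).
  exact: measurable_RV_preimage.
rewrite -preimage_setC probability_setC; last first.
  by apply: mY; do 2 apply: measurableU => //; exact: measurable_set1.
rewrite !preimage_setU measureU; last 3 first.
- by apply: measurableU; apply: mY; exact: measurable_set1.
- by apply: mY; exact: measurable_set1.
- apply/seteqP; split => // z /= [[]-> E].
    by rewrite E eqxx in uw.
  by rewrite E eqxx in vw.
rewrite measureU; last 3 first.
- by apply: mY; exact: measurable_set1.
- by apply: mY; exact: measurable_set1.
- by apply/seteqP; split => // z /= [-> E]; rewrite E eqxx in uv.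
transitivity (1 - (P (Y @^-1` [set u]) + P (Y @^-1` [set v]) + P (Y @^-1` [set w])))%E.
  by [].
by rewrite Pu Pv Pw -!EFinD qmr subrr.
Qed.

Section column.
Context (R : realType) (d : measure_display) (Om : measurableType d).
Variables (P : probability Om R) (n p : nat) (X : 'I_n -> 'I_p -> {RV P >-> R}).

(** The event that a coordinate of the self-normalized sum exceeds [t], cross-multiplied to avoid
    dividing by a possibly zero norm. *)
Definition column_exceeds (t : R) (j : 'I_p) : set Om :=
  [set w | t * Num.sqrt (\sum_(i < n) X i j w ^+ 2) < \sum_(i < n) X i j w].

Lemma measurable_column_exceeds t j : measurable (column_exceeds t j).
Proof.
have mS : measurable_fun setT (fun w => \sum_(i < n) X i j w).
  by apply: measurable_sum => i; exact: measurable_funP.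
have mV : measurable_fun setT (fun w => t * Num.sqrt (\sum_(i < n) X i j w ^+ 2)).
  apply: measurable_realfun.measurable_funM => //.
  apply: (measurableT_comp (measurable_realfun.continuous_measurable_fun (@sqrt_continuous R))).
  by apply: measurable_sum => i; apply: measurable_realfun.measurable_funX; exact: measurable_funP.
rewrite -[X in measurable X]setTI.
exact: (measurable_realfun.measurable_fun_ltr mV mS).
Qed.

End column.

(** Off a null event the column is a configuration with [A] the entries different from [b] and [B]
    those equal to [2 a], so exceedance is covered by the bad configurations. The true masses [q]
    and [r] differ slightly from [2 x / 3] and [x / 3]; [dl] bounds the relative excess of [q], and
    [n dl <= 1] keeps its total effect below a factor [e]. *)
Lemma column_tail (R : realType) : exists2 C : R, 0 <= C &
  forall (d : measure_display) (Om : measurableType d)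
    (P : probability Om R) (n p : nat) (X : 'I_n -> 'I_p -> {RV P >-> R})
    (j : 'I_p) (x dl a b q r t : R),
  mutually_independent (fun ij : 'I_n * 'I_p => X ij.1 ij.2) ->
  (0 < n)%N -> 0 < x <= 1 -> 1 <= t -> 0 < a -> 0 < b -> n%:R * b <= a / 4 ->
  uniq [:: - a; b; 2 * a] -> q + (1 - x) + r = 1 -> 0 <= q -> 0 <= r <= x / 3 ->
  q <= 2 * x / 3 * (1 + dl) -> 0 <= dl -> n%:R * dl <= 1 ->
  (forall i, [/\ P (X i j @^-1` [set - a]) = q%:E,
      P (X i j @^-1` [set b]) = (1 - x)%:E &
      P (X i j @^-1` [set 2 * a]) = r%:E]) ->
  fine (P (column_exceeds X t j)) <=
    (1 - x) ^+ n + C * Num.sqrt (n%:R * x) / t ^+ 4 * expR (- (t ^+ 2 / 2)).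
Proof.
have [C C0 CT] := config_tail R.
exists (expR 1 * C); first by rewrite mulr_ge0 ?expR_ge0.
move=> d Om P n p X j x dl a b q r t ind n0 x01 t1 a0 b0 nb un qr q0 /andP[r0 rx] qx dl0 ndl law.
have /andP[x0 x1] := x01.
have omx : 0 <= 1 - x by rewrite subr_ge0.
pose val (AB : {set 'I_n} * {set 'I_n}) := config_value AB.1 AB.2 (2 * a) (- a) b.
pose E AB := [set w | forall i, X i j w = val AB i].
pose Q (AB : {set 'I_n} * {set 'I_n}) :=
  (AB.2 \subset AB.1) && ((#|AB.1| == 0)%N || bad_config t #|AB.1| #|AB.2|).
have mX (i : 'I_n) (B : set R) : measurable B -> measurable (X i j @^-1` B).
  exact: measurable_RV_preimage.
have mE AB : measurable (E AB).
  by apply: measurable_forall_fin => i; exact: (mX i [set val AB i] (measurable_set1 _)).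
pose N i := X i j @^-1` (~` [set - a; b; 2 * a]).
have mN i : measurable (N i).
  by apply: mX; apply: measurableC; do 2 apply: measurableU => //; exact: measurable_set1.
have PE (AB : {set 'I_n} * {set 'I_n}) : AB.2 \subset AB.1 -> fine (P (E AB)) =
    r ^+ #|AB.2| * q ^+ (#|AB.1| - #|AB.2|) * (1 - x) ^+ (n - #|AB.1|).
  move=> BA.
  have := mutually_independent_column [set j]%SET (val AB) ind.
  rewrite (_ : [set w | _] = E AB); last first.
    apply/seteqP; split => w /= H; first by apply: H; rewrite inE.
    by move=> k; rewrite inE => /eqP ->.
  move=> ->; rewrite /= big_set1 -(prod_config BA); apply: eq_bigr => i _.
  rewrite (config_value_comp _ _ (fun v => fine (P (X i j @^-1` [set v])))).
  by have [-> -> ->] := law i.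
have sub : column_exceeds X t j `<=`
    (\big[setU/set0]_(i < n) N i) `|` (\big[setU/set0]_(AB | Q AB) E AB).
  move=> w Hw; have [[i Ni]|noN] := pselect (exists i, N i w).
    by left; rewrite -bigcup_seq; exists i => //=; rewrite mem_index_enum.
  right.
  pose AB := ([set i | X i j w != b]%SET, [set i | X i j w == 2 * a]%SET).
  have ABE i : X i j w = val AB i.
    have : [set - a; b; 2 * a]%classic (X i j w).
      by apply: contra_notP noN => H; exists i.
    rewrite /val /config_value/= !inE.
    move: un; rewrite /= !inE negb_or andbT => /andP[/andP[ab a2] b2].
    case=> [[]|] -> /=; rewrite ?eqxx ?(negbTE ab) ?(negbTE a2) ?(negbTE b2)//.
  rewrite -bigcup_seq_cond; exists AB => //=.
  rewrite mem_index_enum/= /Q.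
  have BA : AB.2 \subset AB.1.
    apply/fintype.subsetP => i; rewrite !inE => /eqP ->.
    by move: un; rewrite /= !inE negb_or andbT => /andP[_]; rewrite eq_sym.
  rewrite BA/=; apply/orP; right.
  apply: (config_bad BA a0 b0 nb (le_trans ler01 t1)).
  by move: Hw; rewrite /column_exceeds/=; under eq_bigr do rewrite ABE;
    under [X in _ < X -> _]eq_bigr do rewrite ABE.
have mU1 : measurable (\big[setU/set0]_(i < n) N i) by apply: bigsetU_measurable.
have mU2 : measurable (\big[setU/set0]_(AB | Q AB) E AB) by apply: bigsetU_measurable.
have mc := measurable_column_exceeds X t j.
apply: (le_trans (@le_fine_prob _ _ _ P _ _ mc (measurableU _ _ mU1 mU2) sub)).
apply: (le_trans (fine_probU_le P mU1 mU2)).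
have -> : fine (P (\big[setU/set0]_(i < n) N i)) = 0.
  apply: le_anti; rewrite fine_prob_ge0 andbT.
  apply: (le_trans (fine_prob_bigU_le P _ _ mN)).
  rewrite big1// => i _.
  have [l1 l2 l3] := law i.
  by rewrite /N (three_valued_null un _ l1 l2 l3)//.
rewrite add0r; apply: (le_trans (fine_prob_bigU_le P _ _ mE)).
rewrite (eq_bigr (fun AB : {set 'I_n} * {set 'I_n} =>
    r ^+ #|AB.2| * q ^+ (#|AB.1| - #|AB.2|) * (1 - x) ^+ (n - #|AB.1|))); last first.
  by move=> AB /andP[BA _]; exact: PE.
rewrite -(pair_big_dep predT (fun A B : {set 'I_n} =>
    (B \subset A) && ((#|A| == 0)%N || bad_config t #|A| #|B|))
  (fun A B => r ^+ #|B| * q ^+ (#|A| - #|B|) * (1 - x) ^+ (n - #|A|)))/=.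
(* The empty [A] is the column constantly equal to [b], with probability [(1 - x)^n]. *)
rewrite (bigD1 finset.set0)//=; apply: lerD.
  rewrite (big_pred1 finset.set0).
    by rewrite cards0 !expr0 subn0 !mul1r.
  by move=> B; rewrite cards0 eqxx/= andbT finset.subset0.
have cf := CT n x t x01 n0 t1.
have e0 : 0 <= expR 1 :> R by exact: expR_ge0.
have -> : expR 1 * C * Num.sqrt (n%:R * x) / t ^+ 4 * expR (- (t ^+ 2 / 2)) =
  expR 1 * (C * Num.sqrt (n%:R * x) / t ^+ 4 * expR (- (t ^+ 2 / 2))) by ring.
apply: le_trans (ler_wpM2l e0 cf).
rewrite mulr_sumr [leRHS](eq_bigl (fun A : {set 'I_n} => A != finset.set0)); last first.
  by move=> A; rewrite card_gt0.
apply: ler_sum => A A0.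
rewrite cards_eq0 (negbTE A0)/= !mulr_sumr.
apply: ler_sum => B /andP[BA _].
have u1 : (#|B| <= #|A|)%N by apply: subset_leq_card.
(* At most [n] factors [1 + dl], whose product is at most [exp (n dl) <= e]. *)
have hq : q ^+ (#|A| - #|B|) <= (2 * x / 3) ^+ (#|A| - #|B|) * expR 1.
  apply: (@le_trans _ _ ((2 * x / 3 * (1 + dl)) ^+ (#|A| - #|B|))).
    rewrite lerXn2r ?nnegrE//; exact: le_trans qx.
  rewrite exprMn ler_wpM2l ?exprn_ge0//; first by lra.
  have cn : (#|A| - #|B| <= n)%N by rewrite (leq_trans (leq_subr _ _))// -[leqRHS]card_ord max_card.
  apply: (@le_trans _ _ ((1 + dl) ^+ n)); first by rewrite ler_weXn2l// lerDl.
  apply: (@le_trans _ _ (expR dl ^+ n)).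
    by rewrite lerXn2r ?nnegrE ?expR_ge0 ?expR_ge1Dx//; lra.
  by rewrite -expRM_natl ler_expR.
have hr : r ^+ #|B| <= (x / 3) ^+ #|B| by rewrite lerXn2r ?nnegrE//; exact: le_trans rx.
have -> : expR 1 * (x ^+ #|A| * (1 - x) ^+ (n - #|A|) *
    ((1 / 3) ^+ #|B| * (1 - 1 / 3) ^+ (#|A| - #|B|))) =
  (x / 3) ^+ #|B| * ((2 * x / 3) ^+ (#|A| - #|B|) * expR 1) * (1 - x) ^+ (n - #|A|).
  rewrite -{1}(subnKC u1) exprD.
  have -> : x / 3 = x * (1 / 3) by field.
  have -> : 2 * x / 3 = x * (1 - 1 / 3) by field.
  by rewrite !exprMn; ring.
rewrite ler_wpM2r ?exprn_ge0//.
by apply: ler_pM => //; rewrite exprn_ge0.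
Qed.

(** * Gaussian tails *)

Section gaussian_tail.
Import measurable_realfun.
Variable R : realType.
Implicit Types s t : R.

Let N01 : probability (measurableTypeR R) R := normal_prob (0 : R) 1.

Definition gaussian_tail t : R := fine (normal_prob (0 : R) 1 [set` `]t, +oo[%R]).

Lemma gaussian_tail_ge0 t : 0 <= gaussian_tail t.
Proof. exact: (fine_prob_ge0 N01). Qed.

Lemma gaussian_tail_le1 t : gaussian_tail t <= 1.
Proof.
rewrite -lee_fin /gaussian_tail -(@fine_probE _ _ _ N01); last exact: measurable_itv.
by apply: (@probability_le1 _ _ _ N01); exact: measurable_itv.
Qed.

Lemma normal_pdf01E x : normal_pdf 0 1 x =
  normal_peak 1 * expR (- (x ^+ 2 / 2)) :> R.
Proof.
rewrite normal_pdfE ?oner_neq0// /normal_fun subr0 expr1n.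
by congr (_ * expR _); rewrite mulNr.
Qed.

Lemma normal_peak1_le1 : normal_peak 1 <= 1 :> R.
Proof.
rewrite /normal_peak invf_le1 ?sqrtr_gt0.
  rewrite -[leLHS]sqrtr1 ler_wsqrtr// expr1n mul1r mulr2n.
  by have := pi_ge2 R; lra.
by rewrite expr1n mul1r pmulrn_lgt0// pi_gt0.
Qed.

(** Keep only the interval from [t] to [t + 1/t] and bound the density there by its value at the
    right end. As [(t + 1/t)^2 <= t^2 + 3], the loss is the constant [exp (- 3/2)]. *)
Lemma gaussian_tail_ge : exists2 c : R, 0 < c &
  forall t, 1 <= t -> c / t * expR (- (t ^+ 2 / 2)) <= gaussian_tail t.
Proof.
have pk0 : 0 < normal_peak 1 :> R by rewrite normal_peak_gt0 ?oner_neq0.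
exists (normal_peak 1 * expR (- (3 / 2))); first by rewrite mulr_gt0 ?expR_gt0.
move=> t t1; have t0 : 0 < t by lra.
have mI : measurable [set` `]t, t + t^-1[%R] by exact: measurable_itv.
apply: (@le_trans _ _ (fine (N01 [set` `]t, t + t^-1[%R]))); last first.
  apply: (@le_fine_prob _ _ _ N01 _ _ mI (measurable_itv `]t, +oo[)).
  by move=> x /=; rewrite !in_itv/= andbT => /andP[].
rewrite -lee_fin -fine_probE// /N01/= /normal_prob.
set m := normal_peak 1 * expR (- ((t + t^-1) ^+ 2 / 2)).
have m0 : 0 <= m by rewrite mulr_ge0 ?expR_ge0 ?ltW.
have mle (x : R) : t < x -> x < t + t^-1 -> m <= normal_pdf 0 1 x.
  move=> tx xt; rewrite normal_pdf01E ler_wpM2l ?(ltW pk0)// ler_expR lerN2.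
  by rewrite ler_wpM2r// lerXn2r ?nnegrE//; lra.
apply: (@le_trans _ _
    (\int[lebesgue_measure]_(x in [set` `]t, t + t^-1[%R]) (cst m%:E x))%E); last first.
  apply: ge0_le_integral => //.
  - apply: measurable_funTS; apply/measurable_EFinP.
    exact: measurable_normal_pdf.
  - by move=> x /=; rewrite in_itv/= => /andP[tx xt]; rewrite lee_fin; exact: mle.
rewrite integral_cst//= lebesgue_measure_itv/= lte_fin ltrDl invr_gt0 t0.
rewrite -EFinB -EFinM lee_fin addrAC subrr add0r /m.
have -> : normal_peak 1 * expR (- (3 / 2)) / t * expR (- (t ^+ 2 / 2)) =
  normal_peak 1 * (expR (- (3 / 2)) * expR (- (t ^+ 2 / 2))) / t by ring.
rewrite ler_wpM2r ?invr_ge0 ?(ltW t0)// ler_wpM2l ?(ltW pk0)// -expRD ler_expR.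
have it : t^-1 <= 1 by rewrite invf_le1.
have it0 : 0 <= t^-1 by rewrite invr_ge0 ltW.
have -> : (t + t^-1) ^+ 2 = t ^+ 2 + 2 + t^-1 ^+ 2 by field; exact: lt0r_neq0.
have : t^-1 ^+ 2 <= 1 by rewrite expr_le1.
lra.
Qed.

(** The standard Gaussian density is at most 1. *)
Lemma gaussian_tail_lip s t : s <= t -> gaussian_tail s <= gaussian_tail t + (t - s).
Proof.
move=> st.
have mI (i : interval R) : measurable [set` i] by exact: measurable_itv.
have sub : [set` `]s, +oo[%R] `<=` [set` `]t, +oo[%R] `|` [set` `]s, t]%R].
  move=> x /=; rewrite !in_itv/= !andbT => sx; case: (leP x t) => xt.
    by right; rewrite sx.
  by left.
apply: (le_trans (@le_fine_prob _ _ _ N01 _ _ (mI _) (measurableU _ _ (mI _) (mI _)) sub)).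
apply: (le_trans (fine_probU_le N01 (mI _) (mI _))).
rewrite lerD2l -lee_fin -(fine_probE N01)// /N01/= /normal_prob.
apply: (@le_trans _ _ (\int[lebesgue_measure]_(x in [set` `]s, t]%R]) (cst 1%:E x))%E).
  apply: ge0_le_integral => //.
  - by move=> x _; rewrite lee_fin normal_pdf_ge0.
  - apply: measurable_funTS; apply/measurable_EFinP.
    exact: measurable_normal_pdf.
  - move=> x _; rewrite lee_fin; apply: le_trans (normal_pdf_ub _ _ _) normal_peak1_le1.
    exact: oner_neq0.
rewrite integral_cst//= lebesgue_measure_itv/= lte_fin mul1e.
by case: ltP => // _; rewrite lee_fin subr_ge0.
Qed.

End gaussian_tail.

Lemma gaussian_max (R : realType) (d : measure_display) (Om : measurableType d)
    (P : probability Om R) (p : nat) (Z : 'I_p -> {RV P >-> R}) (t : R) :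
  standard_gaussian_vector Z ->
  P (random_vector Z @^-1` [set x : 'rV[R]_p | forall j, x ord0 j <= t]) =
  ((1 - gaussian_tail t) ^+ p)%:E.
Proof.
move=> [ind law].
have -> : random_vector Z @^-1` [set x : 'rV[R]_p | forall j, x ord0 j <= t] =
    [set w | forall j, j \in [set: 'I_p]%SET -> [set` `]-oo, t]%R] (Z j w)].
  apply/seteqP; split => w /= H j.
    by move=> _; rewrite in_itv/=; have := H j; rewrite mxE.
  by rewrite mxE; have := H j; rewrite inE in_itv/=; exact.
rewrite (ind [set: 'I_p]%SET (fun=> [set` `]-oo, t]%R])); last first.
  by move=> j; exact: measurable_itv.
congr (_%:E); rewrite (eq_bigr (fun=> 1 - gaussian_tail t)).
  by rewrite prodr_const finset.cardsT card_ord.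
move=> j _; have /= := law j _ (measurable_itv `]-oo, t]%R).
rewrite /distribution/= /pushforward => ->.
rewrite -(@fine_probC _ _ _ (normal_prob (0 : R) 1)); last exact: measurable_itv.
by congr (fine (_ _)); rewrite setCitvr.
Qed.

(** * The three-point law *)

(** [N] is the number of summands. The bound on [b] makes [N b] and [N b_1] small, so that neither
    the entries [b] nor the bias of the masses accumulates over a column. *)
Definition small_parameter (R : realType) (beta b N : R) : Prop :=
  [/\ 2 <= beta, 1 <= N, 0 < b & b <= 1 / (4 * N * beta ^+ 2)].

Section three_point_bounds.
Variables (R : realType) (beta b N : R).
Hypothesis H : small_parameter beta b N.

Let B1 : 4 <= beta ^+ 2.
Proof.
have [beta2 N1 b0 _] := H.
have -> : 4 = 2 ^+ 2 :> R by ring.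
by rewrite lerXn2r ?nnegrE//; lra.
Qed.

Let Nb : 4 * (N * b) * beta ^+ 2 <= 1.
Proof.
have [beta2 N1 b0 bN] := H; have sq4 := B1.
have h : 0 < 4 * N * beta ^+ 2 by rewrite mulr_gt0//; lra.
have -> : 4 * (N * b) * beta ^+ 2 = b * (4 * N * beta ^+ 2) by ring.
by rewrite -ler_pdivlMr.
Qed.

Let Nb1 : 16 * (N * b) <= 1.
Proof.
have [beta2 N1 b0 _] := H.
apply: le_trans Nb.
have -> : 16 * (N * b) = 4 * (N * b) * 4 by ring.
by rewrite ler_wpM2l// mulr_ge0// mulr_ge0 ?(ltW b0)//; lra.
Qed.

Let b_small : 16 * b <= 1.
Proof.
have [beta2 N1 b0 _] := H.
apply: le_trans Nb1; rewrite ler_wpM2l//.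
by rewrite ler_peMl// ltW.
Qed.

Let b1_gt0 : 0 < tp_b1 beta b.
Proof.
have [beta2 N1 b0 _] := H; have sq4 := B1.
by rewrite /tp_b1 mulr_gt0//; lra.
Qed.

Let Nb1_le : 2 * (N * tp_b1 beta b) <= 1.
Proof.
have [beta2 N1 b0 _] := H.
apply: le_trans Nb; rewrite /tp_b1 -subr_ge0.
have -> : 4 * (N * b) * beta ^+ 2 - 2 * (N * ((2 * beta ^+ 2 - 1) * b)) = 2 * (N * b) by ring.
by rewrite mulr_ge0// mulr_ge0 ?(ltW b0)//; lra.
Qed.

Let b1_le : 2 * tp_b1 beta b <= 1.
Proof.
have [beta2 N1 b0 _] := H.
apply: le_trans Nb1_le; rewrite ler_wpM2l//.
by rewrite ler_peMl// ltW.
Qed.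

Let mid01 : 7 / 8 <= tp_mid beta <= 1.
Proof.
have sq4 := B1.
have i0 : 0 < 2 * beta ^+ 2 by lra.
have h0 : 0 <= 1 / (2 * beta ^+ 2) by rewrite divr_ge0// ltW.
have h1 : 1 / (2 * beta ^+ 2) <= 1 / 8 by rewrite ler_pdivrMr//; lra.
by rewrite /tp_mid; lra.
Qed.

Let rad_ge : 4 * beta ^+ 2 * (255 / 256) <= tp_radicand beta b.
Proof.
have [beta2 N1 b0 _] := H; have sq4 := B1.
have -> : tp_radicand beta b =
  tp_b1 beta b ^+ 2 / 4 + 4 * beta ^+ 2 * (1 - b ^+ 2 * tp_mid beta) by [].
have h0 : 0 <= tp_b1 beta b ^+ 2 / 4 by rewrite divr_ge0 ?sqr_ge0.
have bb : b ^+ 2 <= 1 / 256.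
  have -> : 1 / 256 = (1 / 16) ^+ 2 :> R by field.
  have bs := b_small; rewrite lerXn2r ?nnegrE ?(ltW b0)//; lra.
have bm : b ^+ 2 * tp_mid beta <= 1 / 256.
  by apply: le_trans bb; rewrite ler_piMr ?sqr_ge0//; case/andP: mid01.
rewrite -[leLHS]add0r; apply: lerD => //.
by rewrite ler_wpM2l//; lra.
Qed.

Lemma tp_radicand_ge0 : 0 <= tp_radicand beta b.
Proof.
have sq4 := B1.
by apply: le_trans rad_ge; lra.
Qed.

Let rad_le : tp_radicand beta b <= (tp_b1 beta b / 2 + 2 * beta) ^+ 2.
Proof.
have [beta2 N1 b0 _] := H; have sq4 := B1.
have -> : tp_radicand beta b =
  tp_b1 beta b ^+ 2 / 4 + 4 * beta ^+ 2 * (1 - b ^+ 2 * tp_mid beta) by [].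
rewrite -subr_ge0.
have -> : (tp_b1 beta b / 2 + 2 * beta) ^+ 2 - (tp_b1 beta b ^+ 2 / 4 +
   4 * beta ^+ 2 * (1 - b ^+ 2 * tp_mid beta)) =
   2 * beta * tp_b1 beta b + 4 * beta ^+ 2 * (b ^+ 2 * tp_mid beta) by field.
have /andP[m0 _] := mid01.
apply: addr_ge0; rewrite !mulr_ge0 ?sqr_ge0 ?(ltW b1_gt0)//; lra.
Qed.

Lemma tp_a_ge : beta / 2 <= tp_a beta b.
Proof.
have [beta2 N1 b0 _] := H; have sq4 := B1.
have h : beta <= Num.sqrt (tp_radicand beta b).
  rewrite -[leLHS]ger0_norm ?(le_trans _ beta2)// -sqrtr_sqr ler_wsqrtr//.
  by apply: le_trans rad_ge; lra.
by rewrite /tp_a; have := b1_gt0; lra.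
Qed.

Lemma tp_a_le : tp_a beta b <= 2 * beta.
Proof.
have [beta2 N1 b0 _] := H.
have p0 : 0 <= tp_b1 beta b / 2 + 2 * beta by have := b1_gt0; lra.
have h : Num.sqrt (tp_radicand beta b) <= tp_b1 beta b / 2 + 2 * beta.
  by rewrite -[leRHS]ger0_norm// -sqrtr_sqr ler_wsqrtr.
by rewrite /tp_a; have := b1_le; lra.
Qed.

Lemma tp_a_gt0 : 0 < tp_a beta b.
Proof.
have [beta2 N1 b0 _] := H.
by have := tp_a_ge; lra.
Qed.

(** The quadratic equation of which [a] is the larger root; it expresses that the variance is 1. *)
Lemma tp_a_quadratic :
  tp_a beta b ^+ 2 = tp_b1 beta b / 2 * tp_a beta b +
    beta ^+ 2 * (1 - b ^+ 2 * tp_mid beta).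
Proof.
have S := sqr_sqrtr tp_radicand_ge0.
have : tp_radicand beta b =
  tp_b1 beta b ^+ 2 / 4 + 4 * beta ^+ 2 * (1 - b ^+ 2 * tp_mid beta) by [].
rewrite -S /tp_a; set s := Num.sqrt _ => E.
have -> : beta ^+ 2 * (1 - b ^+ 2 * tp_mid beta) = (s ^+ 2 - tp_b1 beta b ^+ 2 / 4) / 4.
  by rewrite E; field.
by field.
Qed.

Lemma tp_mid_ge0 : 0 <= tp_mid beta.
Proof.
by case/andP: mid01; lra.
Qed.

Lemma tp_Nb_le : N * b <= tp_a beta b / 4.
Proof.
have [beta2 N1 b0 _] := H.
by have := tp_a_ge; have := Nb1; lra.
Qed.

Let slope_ge0 : 0 <= tp_b1 beta b / tp_a beta b.
Proof.
by rewrite divr_ge0 ?ltW ?b1_gt0 ?tp_a_gt0.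
Qed.

Lemma tp_slope_ge0 : 0 <= tp_b1 beta b / tp_a beta b / 2.
Proof.
by rewrite divr_ge0.
Qed.

Lemma tp_slope_le : N * (tp_b1 beta b / tp_a beta b / 2) <= 1.
Proof.
have [beta2 N1 b0 _] := H.
have -> : N * (tp_b1 beta b / tp_a beta b / 2) = (N * tp_b1 beta b / 2) / tp_a beta b.
  by field; rewrite lt0r_neq0// tp_a_gt0.
rewrite ler_pdivrMr ?tp_a_gt0//.
by have := Nb1_le; have := tp_a_ge; lra.
Qed.

Let slope_le1 : tp_b1 beta b / tp_a beta b <= 1.
Proof.
have [beta2 N1 b0 _] := H.
rewrite ler_pdivrMr ?tp_a_gt0//.
by have := b1_le; have := tp_a_ge; lra.
Qed.

Let ib : 0 <= 1 / (6 * beta ^+ 2).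
Proof.
have sq4 := B1.
by rewrite divr_ge0//; lra.
Qed.

Lemma tp_r_ge0 : 0 <= tp_r beta b.
Proof.
by rewrite mulr_ge0// subr_ge0.
Qed.

Lemma tp_r_le : tp_r beta b <= 1 / (2 * beta ^+ 2) / 3.
Proof.
have [beta2 N1 b0 _] := H.
have -> : 1 / (2 * beta ^+ 2) / 3 = 1 / (6 * beta ^+ 2) * 1.
  by field; rewrite lt0r_neq0//; lra.
by rewrite /tp_r ler_wpM2l// gerBl.
Qed.

Lemma tp_q_ge0 : 0 <= tp_q beta b.
Proof.
by rewrite mulr_ge0// addr_ge0.
Qed.

(** With [x = 1 / (2 beta^2)], this exhibits [b_1 / (2 a)] as the relative excess [dl] of
    [column_tail]. *)
Lemma tp_qE : tp_q beta b =
  2 * (1 / (2 * beta ^+ 2)) / 3 * (1 + tp_b1 beta b / tp_a beta b / 2).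
Proof.
have [beta2 N1 b0 _] := H.
by rewrite /tp_q; field; rewrite !lt0r_neq0 ?tp_a_gt0//; lra.
Qed.

Lemma tp_total : tp_q beta b + tp_mid beta + tp_r beta b = 1.
Proof.
have [beta2 N1 b0 _] := H.
by rewrite /tp_q /tp_mid /tp_r; field; rewrite !lt0r_neq0 ?tp_a_gt0//; lra.
Qed.

Lemma tp_mean : - tp_a beta b * tp_q beta b + b * tp_mid beta +
  2 * tp_a beta b * tp_r beta b = 0.
Proof.
have [beta2 N1 b0 _] := H.
rewrite /tp_q /tp_mid /tp_r; set a := tp_a beta b; rewrite /tp_b1.
by field; rewrite !lt0r_neq0 ?tp_a_gt0//; lra.
Qed.

Lemma tp_second_moment : tp_a beta b ^+ 2 * tp_q beta b + b ^+ 2 * tp_mid beta +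
  (2 * tp_a beta b) ^+ 2 * tp_r beta b = 1.
Proof.
have [beta2 N1 b0 _] := H; have sq4 := B1.
have Q := tp_a_quadratic; have a0 := tp_a_gt0.
rewrite /tp_q /tp_r; set a := tp_a beta b in Q a0 *; set c := tp_b1 beta b in Q *.
have -> : a ^+ 2 * (1 / (6 * beta ^+ 2) * (2 + c / a)) + b ^+ 2 * tp_mid beta +
   (2 * a) ^+ 2 * (1 / (6 * beta ^+ 2) * (1 - c / a)) =
   (a ^+ 2 - c / 2 * a) / beta ^+ 2 + b ^+ 2 * tp_mid beta.
  by field; rewrite !lt0r_neq0//; lra.
rewrite Q addrAC subrr add0r mulrAC divff ?mul1r ?subrK//.
by rewrite lt0r_neq0//; lra.
Qed.

Lemma tp_uniq : uniq [:: - tp_a beta b; b; 2 * tp_a beta b].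
Proof.
have [beta2 N1 b0 _] := H.
have a0 := tp_a_gt0; have ab := tp_a_ge.
rewrite /= !inE negb_or andbT; apply/andP; split; [apply/andP; split|];
  rewrite lt_eqF//; have := b_small; lra.
Qed.

Lemma tp_well_definedP : tp_well_defined_mean_zero beta b.
Proof.
split; first by split; [exact: tp_radicand_ge0|rewrite lt0r_neq0 ?tp_a_gt0|exact: tp_uniq].
split; last exact: tp_mean.
by split; [exact: tp_q_ge0|exact: tp_mid_ge0|exact: tp_r_ge0|exact: tp_total].
Qed.

Lemma tp_b_le : b <= 2 * tp_a beta b.
Proof.
have [beta2 N1 b0 _] := H.
by have := tp_a_ge; have := b_small; lra.
Qed.

End three_point_bounds.

(** * Moments of the three-point law and the size of [d_col] *)

Section moments.
Import measurable_realfun.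
Context (R : realType) (d : measure_display) (Om : measurableType d).
Variable P : probability Om R.

(** Off a null set [f \o Y] is a combination of three indicators, and nonnegativity lets the
    integral be split. *)
Lemma three_valued_expectation (Y : {RV P >-> R}) (f : R -> R) (u v w q m r : R) :
  measurable_fun setT f -> (forall y, 0 <= f y) ->
  uniq [:: u; v; w] -> q + m + r = 1 ->
  P (Y @^-1` [set u]) = q%:E -> P (Y @^-1` [set v]) = m%:E ->
  P (Y @^-1` [set w]) = r%:E ->
  'E_P[f \o Y]%E = (f u * q + f v * m + f w * r)%:E.
Proof.
move=> mf f0 un qmr Pu Pv Pw.
have mY (B : set R) : measurable B -> measurable (Y @^-1` B).
  exact: measurable_RV_preimage.
have m1 (c : R) : measurable (Y @^-1` [set c]) by apply: mY; exact: measurable_set1.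
have := three_valued_null un qmr Pu Pv Pw.
move: un; rewrite /= !inE negb_or andbT => /andP[/andP[uv uw] vw].
have [vu wu wv] : [/\ v != u, w != u & w != v] by split; rewrite eq_sym.
rewrite unlock => N0.
pose g (c : R) z : \bar R := ((f c)%:E * (\1_(Y @^-1` [set c]) z)%:E)%E.
have mg (c : R) : measurable_fun setT (g c).
  apply: emeasurable_funM => //.
  by apply/measurable_EFinP; exact: measurable_indic.
have g0 c z : (0 <= g c z)%E by rewrite mule_ge0 ?lee_fin.
have Ig c : (\int[P]_z g c z = (f c)%:E * P (Y @^-1` [set c]))%E.
  rewrite ge0_integralZl_EFin//; first by rewrite integral_indic// setIT.
  by apply/measurable_EFinP; exact: measurable_indic.
transitivity (\int[P]_z (g u z + g v z + g w z))%E.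
  apply: ge0_ae_eq_integral => //.
  - apply/measurable_EFinP; apply: measurableT_comp => //.
  - by apply: emeasurable_funD => //; exact: emeasurable_funD.
  - by move=> z _; rewrite lee_fin; exact: f0.
  - by move=> z _; rewrite !adde_ge0.
  exists (Y @^-1` (~` [set u; v; w])); split => //.
    by apply: mY; apply: measurableC; do 2 apply: measurableU => //; exact: measurable_set1.
  move=> z /= nE; apply: contra_not nE => zV _.
  rewrite /g !indicE.
  have eqm (c : R) : (z \in Y @^-1` [set c]) = (Y z == c).
    by apply/idP/eqP; rewrite inE.
  rewrite !eqm.
  case: zV => [[]|] ->;
    rewrite ?eqxx ?(negbTE uv) ?(negbTE uw) ?(negbTE vw) ?(negbTE vu) ?(negbTE wu) ?(negbTE wv)
      ?mule1 ?mule0 ?adde0 ?add0e//.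
rewrite ge0_integralD//; last 2 first.
- by move=> z _; rewrite adde_ge0.
- exact: emeasurable_funD.
by rewrite ge0_integralD// !Ig Pu Pv Pw -!EFinM -!EFinD.
Qed.

(** The variance is 1 and all values are at most [2 a] in modulus, so the third absolute moment [T]
    is at most [2 a <= 4 beta]. The cube of [d^2] is [n / T^2], free of fractional powers. *)
Lemma d_col_bounds (n p : nat) (X : 'I_n -> 'I_p -> {RV P >-> R}) (j : 'I_p)
  (beta b N : R) : small_parameter beta b N -> (0 < n)%N ->
  (forall i, 'E_P[X i j] = 0)%E ->
  (forall i, has_three_point_law beta b (X i j)) ->
  0 < d_col X j /\ n%:R / (16 * beta ^+ 2) <= (d_col X j ^+ 2) ^+ 3.
Proof.
move=> H n0 EX law.
have [beta2 _ b0 _] := H.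
have nR : 0 < n%:R :> R by rewrite ltr0n.
set a := tp_a beta b; set q := tp_q beta b; set m := tp_mid beta; set r := tp_r beta b.
have a0 : 0 < a := tp_a_gt0 H.
have a0' : 0 <= a by exact: ltW.
have second : a ^+ 2 * q + b ^+ 2 * m + (2 * a) ^+ 2 * r = 1 := tp_second_moment H.
have q0 : 0 <= q := tp_q_ge0 H. have r0 : 0 <= r := tp_r_ge0 H.
have m0 : 0 <= m := tp_mid_ge0 H. have tot := tp_total H. have un := tp_uniq H.
have E (f : R -> R) i : measurable_fun setT f -> (forall y, 0 <= f y) ->
    ('E_P[f \o X i j] = (f (- a) * q + f b * m + f (2 * a) * r)%:E)%E.
  by move=> mf f0; have [l1 l2 l3] := law i; exact: three_valued_expectation.
have V i : ('V_P[X i j] = 1)%E.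
  rewrite /variance unlock EX/=.
  rewrite (_ : (_ * _)%R = (fun y : R => y ^+ 2) \o X i j).
    by rewrite E/= ?sqrrN ?second// => y; exact: sqr_ge0.
  by apply/funext => z /=; rewrite /GRing.mul/= subr0 expr2.
have sig : sigma_col X j = 1.
  rewrite /sigma_col (eq_bigr (fun=> 1)); last by move=> i _; rewrite V.
  by rewrite sumr_const card_ord mulVf ?sqrtr1// lt0r_neq0.
set T := a ^+ 3 * q + b ^+ 3 * m + (2 * a) ^+ 3 * r.
have bet : beta_col X j = T.
  rewrite /beta_col (eq_bigr (fun=> T)).
    by rewrite sumr_const card_ord -(mulr_natl T n) mulKf// lt0r_neq0.
  move=> i _.
  have -> : (fun w => `|X i j w| ^+ 3) = (fun y : R => `|y| ^+ 3) \o X i j by [].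
  rewrite E.
  - by rewrite normrN !ger0_norm ?mulr_ge0 ?(ltW a0) ?(ltW b0).
  - by apply: measurable_funX; exact: normr_measurable.
  - by move=> y; rewrite exprn_ge0.
have Tle : T <= 2 * a.
  have ba : b <= 2 * a := tp_b_le H.
  have e : 2 * a * (a ^+ 2 * q + b ^+ 2 * m + (2 * a) ^+ 2 * r) = 2 * a.
    by rewrite second mulr1.
  rewrite -subr_ge0 -e.
  have -> : 2 * a * (a ^+ 2 * q + b ^+ 2 * m + (2 * a) ^+ 2 * r) - T =
    a ^+ 3 * q + (2 * a - b) * (b ^+ 2 * m) by rewrite /T; ring.
  apply: addr_ge0; first by rewrite mulr_ge0// exprn_ge0// ltW.
  by rewrite mulr_ge0 ?subr_ge0// mulr_ge0// sqr_ge0.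
have T0 : 0 < T.
  have ma0 : 0 < b ^+ 3 * m.
    rewrite mulr_gt0 ?exprn_gt0//.
    rewrite /m /tp_mid subr_gt0 ltr_pdivrMr ?mul1r ?mulr_gt0 ?exprn_gt0//; nra.
  rewrite /T; have h1 : 0 <= a ^+ 3 * q by rewrite mulr_ge0// exprn_ge0.
  have h2 : 0 <= (2 * a) ^+ 3 * r by rewrite mulr_ge0// exprn_ge0// mulr_ge0.
  by apply: ltr_wpDr => //; apply: ltr_wpDl.
have nT : 0 < n%:R * T by rewrite mulr_gt0.
rewrite /d_col sig bet mulr1.
set z := (n%:R * T) `^ _.
have z0 : 0 < z by rewrite powR_gt0.
have z3 : z ^+ 3 = n%:R * T.
  rewrite -powR_mulrn ?(ltW z0)// /z -powRrM mulVf ?powRr1 ?(ltW nT)//.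
have s0 : 0 < Num.sqrt n%:R :> R by rewrite sqrtr_gt0.
split; first by rewrite divr_gt0.
have -> : ((Num.sqrt n%:R / z) ^+ 2) ^+ 3 = n%:R / T ^+ 2.
  have -> : ((Num.sqrt n%:R / z) ^+ 2) ^+ 3 = (Num.sqrt n%:R ^+ 2) ^+ 3 / (z ^+ 3) ^+ 2.
    by field; rewrite lt0r_neq0.
  rewrite z3 sqr_sqrtr ?(ltW nR)//.
  by field; rewrite !lt0r_neq0.
have beta0 : 0 < beta by lra.
rewrite ler_wpM2l ?(ltW nR)// lef_pV2 ?posrE ?mulr_gt0 ?exprn_gt0//.
have -> : 16 * beta ^+ 2 = (2 * (2 * beta)) ^+ 2 by ring.
rewrite lerXn2r ?nnegrE ?(ltW T0)//; first by rewrite !mulr_ge0//; lra.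
by apply: le_trans Tle _; rewrite ler_wpM2l// (tp_a_le H).
Qed.

End moments.

(** * The Kolmogorov-type distance *)

(** If a column vanishes identically, its quotient is 0 by the convention on division and its
    exceedance event reads [0 < 0]; the two agree because [0 <= t]. *)
Lemma self_normalized_preimage (R : realType) (d : measure_display)
    (Om : measurableType d) (P : probability Om R) (n p : nat)
    (X : 'I_n -> 'I_p -> {RV P >-> R}) (t : R) : 0 <= t ->
  self_normalized_sum X @^-1` [set x : 'rV[R]_p | forall j, x ord0 j <= t] =
  [set w | forall j, ~ column_exceeds X t j w].
Proof.
move=> t0; apply/seteqP.
suff H w j : (self_normalized_sum X w ord0 j <= t) = ~~ (`[< column_exceeds X t j w >]).
  by split => w /= Hw j; have := Hw j; rewrite H => /asboolPn.
rewrite mxE (_ : `[< _ >] = (t * Num.sqrt (\sum_(i < n) X i j w ^+ 2) < \sum_(i < n) X i j w)).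
  have V0 : 0 <= \sum_(i < n) X i j w ^+ 2 by apply: sumr_ge0 => i _; exact: sqr_ge0.
  rewrite -leNgt.
  have [Vpos|] := ltP 0 (\sum_(i < n) X i j w ^+ 2).
    by rewrite ler_pdivrMr ?sqrtr_gt0.
  move=> Vle; have V00 : \sum_(i < n) X i j w ^+ 2 = 0 by apply: le_anti; rewrite Vle.
  rewrite V00 sqrtr0 invr0 !mulr0 t0.
  have /psumr_eq0P X0 := V00.
  rewrite big1 ?lexx// => i _; apply/eqP; rewrite -sqrf_eq0; apply/eqP.
  by apply: X0 => // k _; exact: sqr_ge0.
by apply/asboolP/idP.
Qed.

Lemma tau_ge (R : realType) (d d' : measure_display) (Om : measurableType d)
    (Om' : measurableType d') (P : probability Om R) (P' : probability Om' R)
    (p : nat) (T : Om -> 'rV[R]_p) (Z : Om' -> 'rV[R]_p) (t x y e : R) :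
  P (T @^-1` [set x : 'rV[R]_p | forall j, x ord0 j <= t]) = x%:E ->
  P' (Z @^-1` [set x : 'rV[R]_p | forall j, x ord0 j <= t]) = y%:E ->
  e <= `|x - y| -> (e%:E <= tau P P' T Z (@Amax R p))%E.
Proof.
move=> Px Py exy; apply: (@le_trans _ _ `|x%:E - y%:E|%E).
  by rewrite -EFinB abse_EFin lee_fin.
apply: ereal_sup_ubound => /=.
exists [set x : 'rV[R]_p | forall j, x ord0 j <= t]; first by exists t.
by rewrite Px Py.
Qed.

Lemma bernoulli_ge (R : realType) (y : R) (p : nat) : 0 <= y <= 1 ->
  1 - p%:R * y <= (1 - y) ^+ p.
Proof.
move=> /andP[y0 y1]; elim: p => [|p IH]; first by rewrite mul0r subr0 expr0.
rewrite exprS -natr1; have : 0 <= p%:R * y ^+ 2 by rewrite mulr_ge0 ?sqr_ge0.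
have : 0 <= 1 - y by lra.
move=> /ler_wpM2l/(_ _ _ IH) H; lra.
Qed.

Lemma one_minus_exp_le (R : realType) (y : R) (p : nat) : y <= 1 ->
  (1 - y) ^+ p <= expR (- (p%:R * y)).
Proof.
move=> y1; rewrite -mulrN expRM_natl lerXn2r ?nnegrE ?expR_ge0 ?subr_ge0//.
by have := expR_ge1Dx (- y).
Qed.

Lemma expRN_le_one_plus_inv (R : realType) (y : R) : 0 <= y ->
  expR (- y) <= (1 + y)^-1.
Proof.
move=> y0; rewrite expRN lef_pV2 ?posrE ?expR_gt0//; first exact: expR_ge1Dx.
lra.
Qed.

(** * The two cases at fixed [n] *)

Section fixed_n.
Context (R : realType) (d d' : measure_display) (Om : measurableType d)
  (Om' : measurableType d') (P : probability Om R) (P' : probability Om' R).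
Variables (n p : nat) (X : 'I_n -> 'I_p -> {RV P >-> R}) (Z : 'I_p -> {RV P' >-> R}).
Variables (beta b : R).
Hypothesis n0 : (0 < n)%N.
Hypothesis p0 : (0 < p)%N.
Hypothesis Hb : small_parameter beta b n%:R.
Hypothesis ind : mutually_independent (fun ij : 'I_n * 'I_p => X ij.1 ij.2).
Hypothesis law : forall i j, has_three_point_law beta b (X i j).
Hypothesis Zstd : standard_gaussian_vector Z.

Let T := self_normalized_sum X.
Let W := random_vector Z.
Let upto (t : R) := [set x : 'rV[R]_p | forall j, x ord0 j <= t].

Lemma fine_T_upto t : 0 <= t -> P (T @^-1` upto t) = (fine (P (T @^-1` upto t)))%:E.
Proof.
move=> t0; apply: fine_probE; rewrite /T /upto self_normalized_preimage//.
by apply: measurable_forall_fin => j; apply: measurableC; exact: measurable_column_exceeds.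
Qed.

(** Cauchy-Schwarz, read off from the nonnegativity of the empirical variance. *)
Lemma column_exceeds_sqrt_n j w : ~ column_exceeds X (Num.sqrt n%:R) j w.
Proof.
apply/negP; rewrite -leNgt.
set S := \sum_(i < n) X i j w; set V := \sum_(i < n) X i j w ^+ 2.
have V0 : 0 <= V by apply: sumr_ge0 => i _; exact: sqr_ge0.
rewrite -sqrtrM//; apply: le_trans (ler_norm _) _; rewrite -sqrtr_sqr ler_wsqrtr//.
have N0 : 0 < n%:R :> R by rewrite ltr0n.
have : 0 <= \sum_(i < n) (X i j w - S / n%:R) ^+ 2 by apply: sumr_ge0 => i _; exact: sqr_ge0.
have -> : \sum_(i < n) (X i j w - S / n%:R) ^+ 2 = V - S ^+ 2 / n%:R.
  transitivity (\sum_(i < n) (X i j w ^+ 2 - 2 * (S / n%:R) * X i j w + (S / n%:R) ^+ 2)).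
    by apply: eq_bigr => i _; ring.
  rewrite !big_split/= sumrN -mulr_sumr sumr_const card_ord -/S -/V -(mulr_natl (_ ^+ 2)).
  by field; rewrite lt0r_neq0.
by rewrite subr_ge0 ler_pdivrMr// mulrC.
Qed.

Lemma prob_no_constant_column :
  fine (P [set w | forall j, ~ (forall i, X i j w = b)]) = (1 - tp_mid beta ^+ n) ^+ p.
Proof.
rewrite -[in RHS](card_ord p).
apply: (fine_prob_none (F := fun j => [set w | forall i, X i j w = b])).
  move=> j; apply: measurable_forall_fin => i.
  exact: (measurable_RV_preimage (X i j) (measurable_set1 b)).
move=> S; rewrite /= (mutually_independent_column S (fun=> b) ind); congr (_%:E).
rewrite (eq_bigr (fun=> tp_mid beta ^+ n)) ?prodr_const// => j _.
rewrite (eq_bigr (fun=> tp_mid beta)) ?prodr_const ?card_ord// => i _.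
by have [_ -> _] := law i j.
Qed.

Lemma constant_column_exceeds t j w : t < Num.sqrt n%:R ->
  (forall i, X i j w = b) -> column_exceeds X t j w.
Proof.
move=> tn Xb; have [_ _ b0 _] := Hb.
have N0 : 0 < n%:R :> R by rewrite ltr0n.
rewrite /column_exceeds/=.
rewrite (eq_bigr (fun=> b ^+ 2)); last by move=> i _; rewrite Xb.
rewrite [X in _ < X](eq_bigr (fun=> b)); last by move=> i _; rewrite Xb.
rewrite !sumr_const card_ord -[b ^+ 2 *+ n]mulr_natl -[b *+ n]mulr_natl sqrtrM ?(ltW N0)//.
rewrite sqrtr_sqr ger0_norm ?(ltW b0)// mulrA ltr_pM2r//.
rewrite -[ltRHS](@sqr_sqrtr _ n%:R)// expr2 ltr_pM2r// sqrtr_gt0//.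
Qed.

(** At [sqrt n] the maximum of [T] has full mass. If [p] times the Gaussian tail is at least 1/10
    there, the gap is at least 1/11. Otherwise move slightly below [sqrt n]: a constant column still
    exceeds the level, so [T] has mass at most [exp (- 1/4) <= 4/5], while the Gaussian maximum has
    mass at least 17/20. *)
Lemma tau_ge_constant : 1 / 4 <= p%:R * tp_mid beta ^+ n ->
  ((1 / 20)%:E <= tau P P' T W (@Amax R p))%E.
Proof.
move=> ppi; have P0 : 0 < p%:R :> R by rewrite ltr0n.
have P1 : 1 <= p%:R :> R by rewrite ler1n.
have Z' := Zstd.
have s1 : 1 <= Num.sqrt n%:R :> R by rewrite -[leLHS]sqrtr1 ler_wsqrtr// ler1n.
have Q0 := gaussian_tail_ge0 (Num.sqrt n%:R : R).
have Q1 := gaussian_tail_le1 (Num.sqrt n%:R : R).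
have [big|small] := lerP (1 / 10) (p%:R * gaussian_tail (Num.sqrt n%:R : R)).
  apply: (@tau_ge _ _ _ _ _ _ _ _ _ _ (Num.sqrt n%:R) 1 _ _ _ (gaussian_max _ Z')).
    rewrite self_normalized_preimage ?sqrtr_ge0// (_ : mkset _ = setT) ?probability_setT//.
    by apply/seteqP; split => // w _ j /=; exact: column_exceeds_sqrt_n.
  have h1 := one_minus_exp_le p Q1.
  have h2 : expR (- (p%:R * gaussian_tail (Num.sqrt n%:R : R))) <= 10 / 11.
    apply: (@le_trans _ _ (expR (- (1 / 10)))); first by rewrite ler_expR lerN2.
    have -> : 10 / 11 = (1 + 1 / 10)^-1 :> R by field.
    by apply: expRN_le_one_plus_inv; lra.
  rewrite ger0_norm; lra.
(* The offset raises [p] times the Gaussian tail by at most 1/20, to 3/20 in total. *)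
set t := Num.sqrt n%:R - 1 / (20 * p%:R) : R.
have e0 : 0 < 1 / (20 * p%:R) :> R by rewrite divr_gt0// mulr_gt0.
have e1 : 1 / (20 * p%:R) <= 1 / 20 :> R.
  by rewrite ler_pdivrMr ?mulr_gt0//; lra.
have t0 : 0 <= t by rewrite /t; lra.
have tn : t < Num.sqrt n%:R by rewrite /t; lra.
apply: (@tau_ge _ _ _ _ _ _ _ _ _ _ t _ _ _ (fine_T_upto t0) (gaussian_max _ Z')).
have mT : measurable (T @^-1` upto t).
  rewrite /T /upto self_normalized_preimage//.
  by apply: measurable_forall_fin => j; apply: measurableC; exact: measurable_column_exceeds.
have mC : measurable [set w | forall j, ~ (forall i, X i j w = b)].
  apply: measurable_forall_fin => j.
  apply: (@measurableC _ _ [set w | forall i, X i j w = b]).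
  apply: measurable_forall_fin => i.
  exact: (measurable_RV_preimage (X i j) (measurable_set1 b)).
have PT : fine (P (T @^-1` upto t)) <= 4 / 5.
  apply: (@le_trans _ _ (fine (P [set w | forall j, ~ (forall i, X i j w = b)]))).
    apply: le_fine_prob => //; rewrite /T /upto self_normalized_preimage// => w /= H j Xb.
    by apply: (H j); exact: constant_column_exceeds.
  rewrite prob_no_constant_column.
  apply: le_trans (one_minus_exp_le _ _) _.
    rewrite exprn_ile1 ?(tp_mid_ge0 Hb)//.
    have [beta2 _ _ _] := Hb; rewrite /tp_mid gerBl divr_ge0// mulr_ge0 ?sqr_ge0//.
  apply: (@le_trans _ _ (expR (- (1 / 4)))); first by rewrite ler_expR lerN2.
  have -> : 4 / 5 = (1 + 1 / 4)^-1 :> R by field.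
  by apply: expRN_le_one_plus_inv; lra.
have Qt0 := gaussian_tail_ge0 t.
have Qt1 := gaussian_tail_le1 t.
have Qt01 : 0 <= gaussian_tail t <= 1 by rewrite Qt0.
have B := bernoulli_ge p Qt01.
have L : p%:R * gaussian_tail t <= 3 / 20.
  have L := gaussian_tail_lip (ltW tn).
  have tE : Num.sqrt n%:R - t = 1 / (20 * p%:R) by rewrite /t; ring.
  apply: le_trans (ler_wpM2l (ltW P0) L) _; rewrite mulrDr tE.
  have -> : p%:R * (1 / (20 * p%:R)) = 1 / 20 :> R by field; rewrite lt0r_neq0.
  lra.
rewrite distrC ger0_norm; lra.
Qed.

(** By the union bound the maximum of [T] stays below [t] with probability at least 5/8, and the
    Gaussian maximum with probability at most [1/e <= 1/2]. *)
Lemma tau_ge_tail (t K : R) : 0 <= t ->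
  (forall j, fine (P (column_exceeds X t j)) <= tp_mid beta ^+ n + K) ->
  p%:R * tp_mid beta ^+ n <= 1 / 4 -> p%:R * K <= 1 / 8 ->
  1 <= p%:R * gaussian_tail t ->
  ((1 / 20)%:E <= tau P P' T W (@Amax R p))%E.
Proof.
move=> t0 PX ppi pK pQ; have Z' := Zstd.
apply: (@tau_ge _ _ _ _ _ _ _ _ _ _ t _ _ _ (fine_T_upto t0) (gaussian_max _ Z')).
have mE j : measurable (column_exceeds X t j) by exact: measurable_column_exceeds.
have mU : measurable (\big[setU/set0]_(j < p) column_exceeds X t j).
  by apply: bigsetU_measurable.
have -> : T @^-1` upto t = ~` (\big[setU/set0]_(j < p) column_exceeds X t j).
  rewrite /T /upto self_normalized_preimage// -bigcup_seq.
  apply/seteqP; split => w /= Hw; first by move=> [j _]; exact: Hw.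
  by move=> j Ej; apply: Hw; exists j => //=; rewrite mem_index_enum.
rewrite fine_probC//.
have U : fine (P (\big[setU/set0]_(j < p) column_exceeds X t j)) <= 3 / 8.
  apply: le_trans (fine_prob_bigU_le _ _ _ mE) _.
  apply: (@le_trans _ _ (\sum_(j < p) (tp_mid beta ^+ n + K))); first exact: ler_sum.
  by rewrite sumr_const card_ord -(mulr_natl (_ + K)) mulrDr; lra.
have h1 := one_minus_exp_le p (gaussian_tail_le1 t).
have h2 : expR (- (p%:R * gaussian_tail t)) <= 1 / 2.
  apply: (@le_trans _ _ (expR (- 1))); first by rewrite ler_expR lerN2.
  have -> : 1 / 2 = (1 + 1)^-1 :> R by field.
  by apply: expRN_le_one_plus_inv; lra.
rewrite ger0_norm; lra.
Qed.

End fixed_n.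

(** * Choice of the level and the uniform lower bound *)

(** The intermediate value theorem for [t exp (t^2 / 2) = c exp L] between [sqrt L] and
    [sqrt (2 L) + c]. The lower endpoint yields [L <= t^2]. *)
Lemma exists_gaussian_level (R : realType) (c L : R) : 0 < c -> 1 <= L -> 16 / c <= L ->
  exists t, [/\ 1 <= t, L <= t ^+ 2 & c / t * expR (- (t ^+ 2 / 2)) = expR (- L)].
Proof.
move=> c0 L1 cL.
have L0 : 0 <= L by lra.
pose f t : R := t * expR (t ^+ 2 / 2).
have fc : continuous f.
  move=> x; rewrite /continuous_at/f; apply: cvgM; first exact: cvg_id.
  apply: continuous_cvg; first exact: continuous_expR.
  by apply: cvgM; [exact: exprn_continuous|exact: cvg_cst].
set s := Num.sqrt L; set s2 := Num.sqrt (2 * L) + c.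
have sE : s ^+ 2 = L by rewrite sqr_sqrtr.
have s1 : 1 <= s by rewrite -[leLHS]sqrtr1 ler_wsqrtr.
have ss2 : s <= s2.
  by rewrite (@le_trans _ _ (Num.sqrt (2 * L)))// ?ler_wsqrtr ?lerDl ?(ltW c0)//; lra.
have s2L : 2 * L <= s2 ^+ 2.
  have L20 : 0 <= 2 * L by lra.
  rewrite -{1}(sqr_sqrtr L20) lerXn2r ?nnegrE ?sqrtr_ge0 ?addr_ge0 ?sqrtr_ge0 ?(ltW c0)//.
  by rewrite lerDl ltW.
(* Here [exp (L/2) >= L^2 / 16], and [16 / c <= L] makes [c L^2 / 16] at least [L >= sqrt L]. *)
have f1 : f s <= c * expR L.
  rewrite /f sE.
  have -> : expR L = expR (L / 2) * expR (L / 2) by rewrite -expRD; congr expR; field.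
  rewrite mulrA ler_wpM2r ?expR_ge0//.
  have z0 : 0 < L / 2 by lra.
  have := expRN_le_inv_sqr z0.
  rewrite expRN -[leRHS]invrK lef_pV2 ?posrE ?expR_gt0 ?invr_gt0 ?divr_gt0 ?exprn_gt0//.
  rewrite invf_div => h.
  apply: (@le_trans _ _ (c * ((L / 2) ^+ 2 / 4))); last by rewrite ler_wpM2l// ltW.
  have -> : c * ((L / 2) ^+ 2 / 4) = (L * c / 16) * L by field.
  have h16 : 1 <= L * c / 16 by move: cL; rewrite ler_pdivrMr//; lra.
  have sL : s <= L by rewrite -sE expr2 ler_peMl//; lra.
  by apply: le_trans sL _; rewrite ler_peMl.
have f2 : c * expR L <= f s2.
  apply: ler_pM; rewrite ?expR_ge0 ?(ltW c0)//; first by rewrite lerDr sqrtr_ge0.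
  by rewrite ler_expR; lra.
have [|t] := @IVT R f s s2 (c * expR L) ss2 (continuous_subspaceT fc).
  by rewrite ge_min f1 le_max f2 orbT.
rewrite in_itv/= => /andP[st _] ft; exists t.
have t1 : 1 <= t by exact: le_trans st.
split => //.
  by rewrite -sE lerXn2r ?nnegrE//; lra.
rewrite !expRN.
have tn0 : t != 0 by rewrite lt0r_neq0//; lra.
have cn0 : c != 0 by rewrite lt0r_neq0.
have -> : expR L = t * expR (t ^+ 2 / 2) / c by rewrite -/(f t) ft mulrAC divff ?mul1r.
by field; rewrite tn0 cn0 gt_eqF ?expR_gt0.
Qed.

(** The level [t] is where the lower bound on the Gaussian tail equals [1/p]. The constant [A]
    precedes all other data, so it serves every [n] at once. *)
Lemma tau_lower_bound (R : realType) : exists A : R,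
  forall (d d' : measure_display) (Om : measurableType d)
    (Om' : measurableType d') (P : probability Om R) (P' : probability Om' R)
    (n p : nat) (X : 'I_n -> 'I_p -> {RV P >-> R}) (Z : 'I_p -> {RV P' >-> R})
    (j : 'I_p) (beta b : R),
  (0 < n)%N -> small_parameter beta b n%:R ->
  mutually_independent (fun ij : 'I_n * 'I_p => X ij.1 ij.2) ->
  (forall i j, 'E_P[X i j] = 0)%E ->
  (forall i j, has_three_point_law beta b (X i j)) ->
  standard_gaussian_vector Z ->
  16 * beta ^+ 2 <= n%:R ->
  A <= ln p%:R / d_col X j ^+ 2 ->
  ((1 / 20)%:E <= tau P P' (self_normalized_sum X) (random_vector Z) (@Amax R p))%E.
Proof.
have [c c0 cQ] := gaussian_tail_ge R.
have [C C0 CT] := column_tail R.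
have h16 : 0 < 16 / c by rewrite divr_gt0.
have hC : 0 <= (8 * (C / c)) ^+ 2 * 8 by rewrite mulr_ge0 ?sqr_ge0.
(* The second bound makes the level exist; the third gives [sqrt (n x)] much smaller than [t^3]. *)
have [A [A1 A16 AC]] : exists A : R,
    [/\ 1 <= A, 16 / c <= A & (8 * (C / c)) ^+ 2 * 8 <= A].
  by exists (1 + 16 / c + (8 * (C / c)) ^+ 2 * 8); split; lra.
exists A.
move=> d d' Om Om' P P' n p X Z j beta b n0 Hb ind EX law Zstd Mn AL.
have [beta2 N1 b0 _] := Hb.
have p0 : (0 < p)%N by case: p j {X Z ind EX law Zstd AL} => [[]|].
have pR : 0 < p%:R :> R by rewrite ltr0n.
have [d0 dM] := d_col_bounds Hb n0 (fun i => EX i j) (fun i => law i j).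
set D := d_col X j ^+ 2 in AL dM.
have D0 : 0 < D by rewrite exprn_gt0.
set M := n%:R / (16 * beta ^+ 2) in dM.
have beta0 : 0 < beta by lra.
have M1 : 1 <= M by rewrite ler_pdivlMr ?mul1r// mulr_gt0// exprn_gt0.
(* [D^3 >= M >= 1], where [M >= 1] is the assumption [16 beta^2 <= n]; hence [A <= L]. *)
have D1 : 1 <= D.
  rewrite leNgt; apply/negP => Dlt.
  have : D ^+ 3 < 1 by rewrite exprn_ilt1// ltW.
  by lra.
set L := ln p%:R in AL.
have ADL : A * D <= L by rewrite -ler_pdivlMr.
have AleL : A <= L by apply: le_trans ADL; rewrite ler_peMr//; lra.
have pE : p%:R = expR L by rewrite lnK.
have [] := lerP (1 / 4) (p%:R * tp_mid beta ^+ n).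
  exact: tau_ge_constant n0 p0 Hb ind law Zstd.
move=> /ltW ppi.
have L1 : 1 <= L by lra.
have L16 : 16 / c <= L by exact: le_trans AleL.
have [t [t1 tL tc]] := exists_gaussian_level c0 L1 L16.
have t0 : 0 < t by lra.
set x : R := 1 / (2 * beta ^+ 2).
set K := C * Num.sqrt (n%:R * x) / t ^+ 4 * expR (- (t ^+ 2 / 2)).
have sq4 : 4 <= beta ^+ 2.
  have -> : 4 = 2 ^+ 2 :> R by ring.
  by rewrite lerXn2r ?nnegrE//; lra.
have x01 : 0 < x <= 1.
  by rewrite divr_gt0 ?mulr_gt0 ?exprn_gt0//= ler_pdivrMr ?mul1r//; lra.
have PX k : fine (P (column_exceeds X t k)) <= tp_mid beta ^+ n + K.
  apply: (CT d Om P n p X k x (tp_b1 beta b / tp_a beta b / 2) (tp_a beta b) b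
    (tp_q beta b) (tp_r beta b) t ind n0 x01 t1 (tp_a_gt0 Hb) b0 (tp_Nb_le Hb)
    (tp_uniq Hb) (tp_total Hb) (tp_q_ge0 Hb)).
  - by rewrite (tp_r_ge0 Hb) (tp_r_le Hb).
  - by rewrite (tp_qE Hb).
  - exact: (tp_slope_ge0 Hb).
  - exact: (tp_slope_le Hb).
  - by move=> i; exact: law.
have pK : p%:R * K <= 1 / 8.
  set S := Num.sqrt (n%:R * x).
  have S0 : 0 <= S by rewrite sqrtr_ge0.
  have SE : S ^+ 2 = 8 * M.
    have /andP[/ltW x0 _] := x01.
    rewrite sqr_sqrtr; last by rewrite mulr_ge0.
    by rewrite /x /M; field; rewrite lt0r_neq0.
  (* Squared: [n x = 8 M <= 8 D^3], whereas [t^6 >= L^3 >= A^3 D^3]. *)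
  have key : 8 * (C / c) * S <= t ^+ 3.
    rewrite -(@ler_pXn2r _ 2) ?nnegrE ?exprn_ge0 ?(ltW t0)//; last first.
      by rewrite mulr_ge0// mulr_ge0// divr_ge0// ltW.
    have -> : (8 * (C / c) * S) ^+ 2 = (8 * (C / c)) ^+ 2 * 8 * M.
      by rewrite exprMn SE; ring.
    have -> : (t ^+ 3) ^+ 2 = (t ^+ 2) ^+ 3 by ring.
    have M0 : 0 <= M by lra.
    apply: (@le_trans _ _ (A ^+ 3 * D ^+ 3)).
      by apply: ler_pM => //; apply: (le_trans AC); rewrite ler_eXnr.
    have AD0 : 0 <= A * D by rewrite mulr_ge0 ?(ltW D0)// (le_trans _ A1).
    by rewrite -exprMn lerXn2r ?nnegrE ?sqr_ge0//; exact: le_trans ADL tL.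
  (* By the choice of [t]; it cancels the factor [p] and one power of [t] in [p K]. *)
  have e1 : expR (- (t ^+ 2 / 2)) = t / c / p%:R.
    have -> : expR (- (t ^+ 2 / 2)) = t / c * (c / t * expR (- (t ^+ 2 / 2))).
      by field; rewrite !lt0r_neq0.
    by rewrite tc pE expRN.
  have -> : p%:R * K = (8 * (C / c) * S) / (8 * t ^+ 3).
    by rewrite /K e1 -/S; field; rewrite !lt0r_neq0.
  by rewrite ler_pdivrMr ?mulr_gt0 ?exprn_gt0//; lra.
apply: (tau_ge_tail Zstd (ltW t0) PX ppi pK).
have Q := cQ t t1; rewrite tc in Q.
by apply: le_trans (ler_wpM2l (ltW pR) Q); rewrite pE -expRD subrr expR0.
Qed.

(** * Passage to the limit inferior *)

Lemma limn_einf_gt0 (R : realType) (u : (\bar R)^nat) (e : R) :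
  0 < e -> (\forall n \near \oo, (e%:E <= u n)%E) -> (0 < limn_einf u)%E.
Proof.
move=> e0 [N _ Nu]; apply: (@lt_le_trans _ _ e%:E); first by rewrite lte_fin.
rewrite limn_einf_lim (cvg_lim _ (@cvg_einfs_sup _ u))//.
apply: (@le_trans _ _ (einfs u N)); last by apply: ereal_sup_ubound; exists N.
by apply: le_ereal_inf_tmp => _ [k /= Nk <-]; exact: Nu.
Qed.

Theorem proposition2p1 (R : realType) :
  exists bstar : nat -> R -> R,
  forall beta : nat -> R,
    (forall n, (0 < n)%N -> expR 1 <= beta n) ->
    beta n / Num.sqrt n%:R @[n --> \oo] --> (0 : R) ->
    (forall n, (0 < n)%N -> 0 < bstar n (beta n)) /\
    forall b : nat -> R,
      (forall n, (0 < n)%N -> 0 < b n <= bstar n (beta n)) ->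
      (forall n, (0 < n)%N -> tp_well_defined_mean_zero (beta n) (b n)) /\
      forall (p : nat -> nat) (p_gt0 : forall n, (0 < p n)%N)
        (d : nat -> measure_display) (Om : forall n, measurableType (d n))
        (P : forall n, probability (Om n) R)
        (X : forall n, 'I_n -> 'I_(p n) -> {RV (P n) >-> R})
        (d' : nat -> measure_display) (Om' : forall n, measurableType (d' n))
        (P' : forall n, probability (Om' n) R)
        (Z : forall n, 'I_(p n) -> {RV (P' n) >-> R}),
        (forall n, iid (fun ij : 'I_n * 'I_(p n) => X n ij.1 ij.2)) ->
        (forall n i j, ('E_(P n)[X n i j] = 0)%E) ->
        (forall n i j, has_three_point_law (beta n) (b n) (X n i j)) ->
        (forall n, standard_gaussian_vector (Z n)) ->
        ln (p n)%:R / d_col (X n) (Ordinal (p_gt0 n)) ^+ 2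
          @[n --> \oo] --> +oo ->
        (0 < limn_einf (fun n =>
               tau (P n) (P' n) (self_normalized_sum (X n))
                   (random_vector (Z n)) (@Amax R (p n))))%E.
Proof.
have [A HA] := tau_lower_bound R.
(* The threshold is the bound of [small_parameter] with [N = n]. *)
exists (fun n beta => 1 / (4 * n%:R * beta ^+ 2)) => beta beta_e beta_n.
have beta2 n : (0 < n)%N -> 2 <= beta n.
  by move=> n0; apply: le_trans (beta_e n n0); have := expR_ge1Dx (1 : R); lra.
have nR n : (0 < n)%N -> 1 <= n%:R :> R by rewrite ler1n.
split=> [n n0|b Hb].
  have b2 := beta2 n n0; have n1 := nR n n0.
  by rewrite divr_gt0// mulr_gt0 ?exprn_gt0//; lra.
have small n : (0 < n)%N -> small_parameter (beta n) (b n) n%:R.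
  by move=> n0; have /andP[b0 bb] := Hb n n0; split; rewrite ?beta2 ?nR.
split=> [n n0|]; first exact: tp_well_definedP (small n n0).
move=> p p_gt0 d Om P X d' Om' P' Z Xiid EX law Zstd pd.
apply: (@limn_einf_gt0 _ _ (1 / 20)); first by lra.
near=> n.
have n0 : (0 < n)%N by near: n; exact: nbhs_infty_gt.
have [ind _] := Xiid n.
apply: (HA _ _ _ _ _ _ _ _ _ _ (Ordinal (p_gt0 n)) _ _ n0 (small n n0) ind (EX n) (law n) (Zstd n)).
  have n1 := nR n n0.
  have s0 : 0 < Num.sqrt n%:R :> R by rewrite sqrtr_gt0; lra.
  (* Eventually true by the growth condition on [beta]; squaring it gives [16 beta^2 <= n]. *)
  have : `|beta n / Num.sqrt n%:R| <= 1 / 4.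
    by near: n; apply: (cvgr0_norm_le _ beta_n); lra.
  have b2 := beta2 n n0.
  rewrite ger0_norm; last by rewrite divr_ge0 ?(ltW s0)//; lra.
  rewrite ler_pdivrMr// => bs.
  have : (4 * beta n) ^+ 2 <= Num.sqrt n%:R ^+ 2.
    by rewrite lerXn2r ?nnegrE ?(ltW s0)//; lra.
  rewrite exprMn sqr_sqrtr; last by lra.
  by lra.
by near: n; move/cvgryPge: pd; apply.
Unshelve. all: by end_near.
Qed.
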